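(* Let $G$ be a nonbipartite connected unicyclic graph of order $n\geq 3$ with domination number $\frac{n-1}{2}$. Then $q_{min}(G)\geq q_{min}(\mathscr{H}_{3,\frac{n-3}{2}})$, with equality if and only if $G\cong\mathscr{H}_{3,\frac{n-3}{2}}$.
   Context: $q_{min}$ is the least eigenvalue of the signless Laplacian $Q=D+A$; a unicyclic graph is a connected graph with as many edges as vertices; the domination number is the minimum size of a vertex set $D$ such that every vertex outside $D$ is adjacent to a vertex of $D$. For $n=3$, $\mathscr{H}_{3,0}$ is the triangle $C_3$. For odd $n\geq 5$, $\mathscr{H}_{3,\frac{n-3}{2}}$ is the graph of order $n$ formed by a triangle $v_1v_2v_3v_1$, a path $v_3v_4\cdots v_{\frac{n+5}{2}}$, and one pendant vertex attached to each of $v_4,\ldots,v_{\frac{n+1}{2}}$. *)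

(* Defs.v *)
From mathcomp Require Import all_boot all_order all_algebra.
From mathcomp Require Import classical_sets reals.
From mathcomp Require Import complex polyrcf zify.

Set Implicit Arguments.
Unset Strict Implicit.
Unset Printing Implicit Defensive.

Import Order.TTheory GRing.Theory Num.Theory.
Local Open Scope ring_scope.

Record sgraph := SGraph {
  vertex :> finType;
  adj : rel vertex;
  adj_sym : symmetric adj;
  adj_irrefl : irreflexive adj
}.

Definition edges (G : sgraph) : {set {set G}} :=
  [set [set p.1; p.2] | p : G * G & adj p.1 p.2].

Definition connected (G : sgraph) : Prop :=
  forall x y : G, connect (@adj G) x y.

Definition unicyclic (G : sgraph) : Prop :=
  connected G /\ #|edges G| = #|G|.

Definition bipartite (G : sgraph) : Prop :=
  exists c : G -> bool, forall x y : G, adj x y -> c x != c y.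

Definition isomorphic (G H : sgraph) : Prop :=
  exists2 f : G -> H, bijective f & forall x y : G, adj (f x) (f y) = adj x y.

Definition dominating (G : sgraph) (D : {set G}) : bool :=
  [forall x in ~: D, exists y in D, adj x y].

Definition domination_number (G : sgraph) : nat :=
  #|[arg min_(D < [set: G] | dominating D) #|D| ]|.

Lemma domination_numberP (G : sgraph) :
  (exists2 D : {set G}, dominating D & #|D| = domination_number G) /\
  (forall D : {set G}, dominating D -> (domination_number G <= #|D|)%N).
Proof.
rewrite /domination_number; case: arg_minnP => [|D domD minD].
  by apply/forall_inP => x; rewrite !inE.
by split; [exists D | apply: minD].
Qed.

Definition degree (G : sgraph) (x : G) : nat := #|[set y | adj x y]|.

Definition adjacency_mx (R : realType) (G : sgraph) : 'M[R]_#|G| :=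
  \matrix_(i, j) (adj (enum_val i) (enum_val j))%:R.

Definition degree_mx (R : realType) (G : sgraph) : 'M[R]_#|G| :=
  diag_mx (\row_i (degree (enum_val i))%:R).

Definition signless_laplacian (R : realType) (G : sgraph) : 'M[R]_#|G| :=
  degree_mx R G + adjacency_mx R G.

(* The infimum is a minimum as soon as G has a vertex, see q_minP. *)
Definition q_min (R : realType) (G : sgraph) : R :=
  inf [set a : R | eigenvalue (signless_laplacian R G) a]%classic.

Lemma tr_signless_laplacian (R : realType) (G : sgraph) :
  (signless_laplacian R G)^T = signless_laplacian R G.
Proof.
rewrite linearD /= tr_diag_mx; congr (_ + _).
by apply/matrixP => i j; rewrite !mxE adj_sym.
Qed.

Lemma symmetric_eigenvalue (R : rcfType) n (A : 'M[R]_n) :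
  (0 < n)%N -> A^T = A -> exists a, eigenvalue A a.
Proof.
move=> n_gt0 symA; pose AC := map_mx (real_complex R) A.
have [z zA] := eigenvalue_closed AC n_gt0.
suff zR : z^* = z.
  have /RRe_real zE : z \is Num.real by apply/CrealP.
  by exists (complex.Re z); move: zA; rewrite -{1}zE eigenvalue_map.
have /eigenvalueP[v vA v0] := zA.
pose w := map_mx Num.conj v.
have wA : w *m AC = z^* *: w.
  have <- : map_mx Num.conj AC = AC.
    apply/matrixP => i j; rewrite !mxE; apply: conj_Creal.
    by rewrite complex_real.
  by rewrite -map_mxM vA map_mxZ.
have symAC : AC^T = AC by rewrite map_trmx symA.
have vw : z *: (v *m w^T) = z^* *: (v *m w^T).
  rewrite scalemxAl -vA -mulmxA -[in LHS]symAC -trmx_mul wA.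
  by rewrite linearZ /= -scalemxAr.
apply/esym/eqP; rewrite -subr_eq0; apply/eqP.
have /eqP := vw; rewrite -subr_eq0 -scalerBl scaler_eq0 => /orP[/eqP //|].
case/eqP/matrixP/(_ 0 0)/eqP; rewrite !mxE psumr_eq0 => [/allP vv|i _].
  case/negP: v0; apply/eqP/rowP => i; rewrite mxE.
  have := vv i (mem_index_enum _); rewrite !mxE -normCK expf_eq0 /=.
  by rewrite normr_eq0 => /eqP.
by rewrite !mxE -normCK exprn_ge0.
Qed.

Lemma q_minP (R : realType) (G : sgraph) : (0 < #|G|)%N ->
  eigenvalue (signless_laplacian R G) (q_min R G) /\
  (forall a, eigenvalue (signless_laplacian R G) a -> q_min R G <= a).
Proof.
move=> G_gt0; set Q := signless_laplacian R G.
have [a0 a0Q] := symmetric_eigenvalue G_gt0 (tr_signless_laplacian R G).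
have p0 : char_poly Q != 0 by rewrite monic_neq0 ?char_poly_monic.
pose s := rootsR (char_poly Q).
have sP a : eigenvalue Q a = (a \in s).
  by rewrite eigenvalue_root_char -(roots_on_rootsR p0) in_itv.
pose m := \big[Order.min/a0]_(a <- s) a.
have mQ : eigenvalue Q m.
  rewrite /m big_seq; elim/big_ind: _ => [//|x y|a]; last by rewrite sP.
  by rewrite /Order.min; case: ifP.
have mle a : eigenvalue Q a -> m <= a.
  by rewrite sP => /ge_bigmin_seq; apply.
have -> : q_min R G = m; last by [].
apply/eqP; rewrite eq_le; apply/andP; split.
  by apply: ge_inf => //; exists m => a; apply: mle.
by apply: lb_le_inf; [exists m | move=> a; apply: mle].
Qed.

(* H3 k is the graph written H_{3,k}, of order n = 2k + 3. The vertex v_i of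
   the triangle and of the path is numbered i - 1, for 1 <= i <= k + 4, and the
   pendant vertex at v_i is numbered k + i, for 4 <= i <= k + 2. When k = 0 the
   ordinals stop at 2, which leaves the triangle alone. *)
Definition H3_arc (k i j : nat) : bool :=
  [|| (i, j) \in [:: (0, 1); (1, 2); (0, 2)]%N,
      [&& (2 <= i)%N, j == i.+1 & (j < k + 4)%N]
    | (k + 4 <= j)%N && (j == k + i.+1)%N].

Definition H3_adj (k : nat) : rel 'I_(k.*2 + 3) :=
  fun i j => H3_arc k i j || H3_arc k j i.

Lemma H3_adj_sym k : symmetric (@H3_adj k).
Proof. by move=> i j; rewrite /H3_adj orbC. Qed.

Lemma H3_adj_irrefl k : irreflexive (@H3_adj k).
Proof.
move=> i; rewrite /H3_adj orbb /H3_arc !inE !xpair_eqE.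
by move: (ltn_ord i) => ?; lia.
Qed.

Definition H3 (k : nat) : sgraph := SGraph (@H3_adj_sym k) (@H3_adj_irrefl k).

(* Main.v *)
Require Import Defs.
From mathcomp Require Import all_boot all_order all_algebra.
From mathcomp Require Import reals complex.
From mathcomp Require Import spectral sesquilinear.
From mathcomp Require Import ring lra zify.

(* A nonbipartite unicyclic graph is functional: its edges are the pairs
   {x, nxt x} of a map nxt with a single cycle, which is odd, so that its
   signless quadratic form is the sum of the (f x + f (nxt x))^2. The domination
   number being (n - 1)/2, the vertices outside the cycle can be arranged into
   pairs (x, y) such that nxt x and nxt y are on the cycle or are first
   components of pairs that come earlier (for nxt y, x itself is allowed).
   Reading off the edge values |f x + f (nxt x)| along this arrangement defines
   a vector on a comb whose t-th tooth is the t-th pair: its energy is that of f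
   and by the triangle inequality its entries dominate |f|. If the cycle is a
   triangle, hanging the comb from the triangle vertex where |f| is largest gives
   a test vector on H_{3,k}. A longer cycle is first split, by the reflection
   fixing the vertex where |f| is largest, into a symmetric part, which is folded
   onto a triangle with a comb, and an antisymmetric part, which is treated
   separately. Equality forces all edge values of the test vector to be positive,
   hence every pair to hang from the previous one. *)

Set Implicit Arguments.
Unset Strict Implicit.
Unset Printing Implicit Defensive.

(** * Unicyclic graphs as functional graphs *)

Section SpanningTree.
Variables (V : finType) (e : rel V) (r : V).
Hypothesis to_r : forall v, connect e v r.

Fixpoint walk_to n v :=
  if n is m.+1 then [exists u, e v u && walk_to m u] else v == r.

Lemma ex_walk_to v : exists n, walk_to n v.
Proof.
have /connectP[s sP rE] := to_r v; exists (size s).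
elim: s v sP rE => [|u s IHs] v /=; first by move=> _ ->.
by case/andP=> vu us rE; apply/existsP; exists u; rewrite vu IHs.
Qed.

Definition depth v := ex_minn (ex_walk_to v).

Lemma depth_root : depth r = 0.
Proof. by rewrite /depth; case: ex_minnP => m _ /(_ 0); rewrite /= eqxx => /(_ isT); lia. Qed.

(** Breadth-first search: [d] is the distance to [r], and [p v] is a neighbour of [v] one step
    closer. *)
Lemma spanning_tree : exists (p : V -> V) (d : V -> nat),
  d r = 0 /\ forall v, v != r -> e v (p v) /\ d v = (d (p v)).+1.
Proof.
suff ex v : v != r -> exists u, e v u && (depth v == (depth u).+1).
  exists (fun v => if [pick u | e v u && (depth v == (depth u).+1)] is Some u
                   then u else v), depth; split=> [|v vr]; first exact: depth_root.
  case: pickP => [u /andP[vu /eqP dv] //|no].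
  by have [u] := ex v vr; rewrite no.
rewrite {1}/depth; case: ex_minnP => [[|n] /=]; first by move=> ->.
case/existsP=> u /andP[vu un] min _; exists u; rewrite vu /=.
rewrite /depth; case: ex_minnP => m um minu.
rewrite eqn_leq; apply/andP; split; last by rewrite ltnS minu.
by apply: min => /=; apply/existsP; exists u; rewrite vu.
Qed.

End SpanningTree.

Lemma set2_eq (T : finType) (x y a b : T) :
  ([set x; y] == [set a; b]) =
  (x == a) && (y == b) || (x == b) && (y == a).
Proof.
apply/eqP/idP => [E|/orP[] /andP[/eqP-> /eqP->] //]; last by rewrite setUC.
have xab : x \in [set a; b] by rewrite -E set21.
have yab : y \in [set a; b] by rewrite -E set22.
have axy : a \in [set x; y] by rewrite E set21.
have bxy : b \in [set x; y] by rewrite E set22.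
move: xab yab axy bxy; rewrite !inE ![a == _]eq_sym ![b == _]eq_sym.
by case: (x == a); case: (x == b); case: (y == a); case: (y == b).
Qed.

Section Parent.
Variables (G : sgraph) (r : G) (p : G -> G) (d : G -> nat).
Hypothesis pP : forall v, v != r -> adj v (p v) /\ d v = (d (p v)).+1.

Definition tree_edges : {set {set G}} := [set [set v; p v] | v in [set~ r]].

(** Two vertices with the same edge would be parents of each other, which the depths exclude. *)
Lemma card_tree_edges : #|tree_edges| = #|G|.-1.
Proof.
rewrite card_in_imset ?cardsC1 // => u v; rewrite !inE => /pP[_ du] /pP[_ dv].
move=> /eqP; rewrite set2_eq => /orP[/andP[/eqP //]|/andP[/eqP uE /eqP vE]].
by move: du dv; rewrite vE -uE; lia.
Qed.

Lemma tree_edges_sub : tree_edges \subset edges G.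
Proof.
apply/subsetP => s /imsetP[v]; rewrite !inE => /pP[vp _] ->.
by apply/imsetP; exists (v, p v); rewrite ?inE.
Qed.

End Parent.

(** A spanning tree has one edge fewer than [G]; let [{a, b}] be the edge left out. Orienting the
    other edges towards [a] and adding the arc from [a] to [b] gives [nxt]. *)
Lemma unicyclic_functional (G : sgraph) : (0 < #|G|) -> unicyclic G ->
  exists (nxt : G -> G) (a : G),
  [/\ forall x y, adj x y = (y == nxt x) || (x == nxt y),
      forall x, nxt (nxt x) != x &
      forall x, fconnect nxt x a].
Proof.
move=> G0 [Gc Ge]; have [r _] := card_gt0P G0.
have edgesP x y : adj x y -> [set x; y] \in edges G.
  by move=> xy; apply/imsetP; exists (x, y); rewrite ?inE.
have [p0 [d0 [_ p0P]]] := spanning_tree (fun v => Gc v r).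
have [E0 E0E] : exists E0, edges G :\: tree_edges r p0 = [set E0].
  apply/cards1P; rewrite cardsD (setIidPr (tree_edges_sub p0P)).
  by rewrite (card_tree_edges p0P) Ge; lia.
have: E0 \in edges G :\: tree_edges r p0 by rewrite E0E set11.
rewrite inE => /andP[E0T /imsetP[[a b]]]; rewrite inE /= => ab E0ab.
rewrite {}E0ab in E0E E0T.
pose e x y := adj x y && ([set x; y] != [set a; b]).
have e_sym : connect_sym e.
  by apply: sym_connect_sym => x y; rewrite /e adj_sym setUC.
have e_to v : connect e v a.
  suff to_r u : connect e u r by rewrite (connect_trans (to_r v)) // e_sym.
  elim: {u}(d0 u) {-2}u (erefl (d0 u)) => [|n IHn] u du.
    by case: (eqVneq u r) => [-> //|/p0P[_]]; rewrite du.
  case: (eqVneq u r) => [-> //|ur]; have [up du'] := p0P _ ur.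
  apply: connect_trans (IHn (p0 u) _); last by lia.
  apply: connect1; rewrite /e up; apply: contra E0T => /eqP <-.
  by apply/imsetP; exists u; rewrite ?inE.
(* The tree is rebuilt with root [a]; by counting, it again consists of all edges but [{a, b}]. *)
have [p [d [_ pP]]] := spanning_tree e_to.
have pP' v : v != a -> adj v (p v) /\ d v = (d (p v)).+1.
  by case/pP => /andP[].
have TE : tree_edges a p = edges G :\ [set a; b].
  apply/eqP; rewrite eqEcard; apply/andP; split.
    apply/subsetP => s /imsetP[v]; rewrite !inE => /pP[/andP[vp ne] _] ->.
    by rewrite ne edgesP.
  have := cardsD1 [set a; b] (edges G); rewrite edgesP //.
  by rewrite (card_tree_edges pP') Ge add1n => ->.
have bNa : b != a by apply: contraTneq ab => ->; rewrite adj_irrefl.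
(* This excludes a 2-cycle of [nxt] between [a] and [b]. *)
have pb v : v != a -> p v = a -> v != b.
  move=> va pva; have [/andP[_ ne] _] := pP _ va; rewrite pva in ne.
  by apply: contra ne => /eqP->; rewrite setUC.
exists (fun v => if v == a then b else p v); exists a; split=> [x y|x|x].
- apply/idP/orP; last first.
    have arc u v : v == (if u == a then b else p u) -> adj u v.
      by move/eqP->; case: eqVneq => [->|/pP'[]].
    by case=> /arc //; rewrite adj_sym.
  move=> xy; have /edgesP := xy; case: (eqVneq [set x; y] [set a; b]) => [E _|E xyE].
    move/eqP: E; rewrite set2_eq => /orP[]/andP[/eqP-> /eqP->]; rewrite eqxx; auto.
  have: [set x; y] \in tree_edges a p by rewrite TE !inE E.
  case/imsetP=> v; rewrite !inE => va /eqP; rewrite set2_eq.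
  by case/orP=> /andP[/eqP-> /eqP->]; rewrite (negPf va) eqxx; auto.
- case: (eqVneq x a) => [->|xa].
    by rewrite (negPf bNa); apply/eqP=> /(pb _ bNa); rewrite eqxx.
  case: (eqVneq (p x) a) => [/(pb _ xa)|pxa]; first by rewrite eq_sym.
  have [_ dx] := pP _ xa; have [_ dpx] := pP _ pxa.
  by apply: contraPneq dpx => ->; lia.
- elim: {x}(d x) {-2}x (erefl (d x)) => [|n IHn] x dx.
    by case: (eqVneq x a) => [-> //|/pP[_]]; rewrite dx.
  case: (eqVneq x a) => [-> //|xa]; have [_ dpx] := pP _ xa.
  apply: connect_trans (IHn (p x) _); last by lia.
  by apply: connect1; rewrite /= (negPf xa).
Qed.

(** * The cycle and its odd length *)

Section Cycle.
Variables (G : sgraph) (nxt : G -> G) (a : G).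
Hypothesis adjE : forall x y, adj x y = (y == nxt x) || (x == nxt y).
Hypothesis nxt2 : forall x, nxt (nxt x) != x.
Hypothesis to_a : forall x, fconnect nxt x a.
Hypothesis nonbip : ~ bipartite G.

Definition cyc : {set G} := [set x | fconnect nxt a x].
Local Notation C := cyc.

Lemma nxt1 x : nxt x != x.
Proof.
apply/eqP => xx; have := adj_irrefl x.
by rewrite adjE xx eqxx.
Qed.

Lemma cyc_nxt x : x \in C -> nxt x \in C.
Proof. by rewrite !inE => /connect_trans-> //; apply: fconnect1. Qed.

Lemma to_cyc v w : w \in C -> fconnect nxt v w.
Proof. by rewrite inE; apply: connect_trans. Qed.

Lemma cyc_prev w : w \in C -> exists2 y, y \in C & nxt y = w.
Proof.
move=> wC; have nwC := cyc_nxt wC; have /iter_findex := to_cyc (nxt w) wC.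
case: (findex _ _ _) => [|i] /= ww; first by have := nxt1 w; rewrite ww eqxx.
exists (iter i nxt (nxt w)) => //; elim: i {ww} => //= i; exact: cyc_nxt.
Qed.

(** [d] counts the steps of [nxt] until [w] is reached. If [d (nxt w)] were odd, the parity of [d]
    would be a proper 2-colouring. *)
Lemma hitting_time w : w \in C -> exists d : G -> nat,
  [/\ d w = 0, forall v, v != w -> d v = (d (nxt v)).+1 & ~~ odd (d (nxt w))].
Proof.
move=> wC; have toC v := to_cyc v wC.
have [p [d [dw pP]]] := spanning_tree toC.
have dP v : v != w -> d v = (d (nxt v)).+1 by case/pP=> /eqP->.
exists d; split=> //; apply/negP => odd_nw; apply: nonbip.
exists (fun v => odd (d v)).
suff col v : odd (d v) != odd (d (nxt v)).
  by move=> x y; rewrite adjE => /orP[]/eqP-> //; rewrite eq_sym.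
case: (eqVneq v w) => [->|/dP->]; first by rewrite dw odd_nw.
by rewrite /=; case: odd.
Qed.

(** The first return time to [w] is d (nxt w) + 1; it is odd by [hitting_time], and it is not 1
    because [nxt] has no fixed point. *)
Lemma cyc_traject w (s := [seq iter i nxt w | i <- iota 0 #|C|]) :
  w \in C -> [/\ odd #|C|, (2 < #|C|)%N, iter #|C| nxt w = w, uniq s & s =i C].
Proof.
rewrite {}/s => wC; have [d [dw dP even_nw]] := hitting_time wC.
pose g := (d (nxt w)).+1.
have dg i : (i < g)%N -> d (iter i.+1 nxt w) = g - i.+1.
  elim: i => [|i IHi] ig /=; first by rewrite /g subn1.
  have di := IHi (ltnW ig); have := dP (iter i.+1 nxt w).
  case: eqVneq => [E|_ /(_ isT)]; last by rewrite di /=; lia.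
  by move: di; rewrite E dw; lia.
have gw : iter g nxt w = w.
  have := dg g.-1; rewrite /= => /(_ (leqnn _)); rewrite -/g subnn => d0.
  by case: (eqVneq (iter g nxt w) w) => // /dP; rewrite d0.
pose s := [seq iter i nxt w | i <- iota 0 g].
have us : uniq s.
  rewrite map_inj_in_uniq ?iota_uniq // => i j; rewrite !mem_iota !add0n /=.
  have dj k : (k < g)%N -> d (iter k nxt w) = if k is 0 then 0 else g - k.
    by case: k => [|k] kg //; rewrite dg // ltnW.
  move=> ig jg E; have := dj i ig; rewrite E dj //.
  by case: i j ig jg {E} => [|i] [|j]; lia.
have sC : s =i C.
  move=> x; apply/mapP/idP => [[i _ ->]|xC].
    by elim: i => //= i; apply: cyc_nxt.
  have /iter_findex <- := to_cyc w xC; move: (findex _ _ _) => i.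
  exists (i %% g)%N; first by rewrite mem_iota /= ltn_mod.
  rewrite {1}(divn_eq i g) addnC iterD; congr (iter _ _ _).
  by rewrite iterM; elim: (i %/ g)%N => // j IHj; rewrite iterS IHj gw.
have -> : #|C| = g by rewrite -(eq_card sC) (card_uniqP us) size_map size_iota.
split=> //.
have: d (nxt w) != 0.
  by apply/eqP => d0; have := nxt1 w; case: eqVneq => // /dP; rewrite d0.
by move: even_nw; rewrite /g; case: (d (nxt w)) => [|[|]].
Qed.

Lemma cyc_root : a \in C.
Proof. by rewrite inE. Qed.

Lemma card_cyc : odd #|C| /\ (2 < #|C|)%N.
Proof.
by have [] := cyc_traject cyc_root.
Qed.

End Cycle.

(** * The forest hanging from the cycle when the domination number is extremal *)

Section Domination.
Variables (G : sgraph) (nxt : G -> G) (a : G).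
Hypothesis adjE : forall x y, adj x y = (y == nxt x) || (x == nxt y).
Hypothesis nxt2 : forall x, nxt (nxt x) != x.
Hypothesis to_a : forall x, fconnect nxt x a.
Hypothesis nonbip : ~ bipartite G.
Local Notation C := (cyc nxt a).

(** The dominating vertices may lie outside [S], so that lower bounds survive when vertices are
    stripped from [S]. *)
Definition covers (D S : {set G}) :=
  [forall x in S, (x \in D) || [exists y in D, adj x y]].

Definition needs (S : {set G}) (m : nat) :=
  forall D : {set G}, covers D S -> (m <= #|D|)%N.

Definition nxt_closed (S : {set G}) :=
  C \subset S /\ forall x, x \in S -> nxt x \in S.

Lemma coversI (D S : {set G}) :
  (forall x, x \in S -> x \notin D ->
     nxt x \in D \/ exists2 y, y \in D & nxt y = x) -> covers D S.
Proof.
move=> DS; apply/forall_inP => x /DS; case: (boolP (x \in D)) => //= _ /(_ isT).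
case=> [nD|[y yD <-]]; apply/existsP.
  by exists (nxt x); rewrite nD adjE eqxx.
by exists y; rewrite yD adjE eqxx orbT.
Qed.

(** The two parity classes of the distance to [a] are disjoint and each covers [S]: every vertex
    other than [a] is followed by one of the other class, and [a] is preceded on the cycle by an odd
    one. *)
Lemma needs_half S m : nxt_closed S -> needs S m -> (m.*2 <= #|S|)%N.
Proof.
move=> [CS nS] Sm; have aC : a \in C := cyc_root to_a.
have [d [da dP _]] := hitting_time adjE to_a nonbip aC.
have [z zC za] := cyc_prev adjE to_a aC.
have zNa : z != a by rewrite -za eq_sym (nxt1 adjE).
pose P := [set x in S | odd (d x)].
have SP : #|S| = (#|S :&: P| + #|S :\: P|)%N by rewrite cardsID.
have odd_dom : covers (S :&: P) S.
  apply: coversI => x xS; rewrite !inE xS /= => even_x.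
  case: (eqVneq x a) => [->|/dP dx]; [right; exists z => // | left].
    by rewrite !inE (subsetP CS) //= dP // za da.
  by rewrite ?inE nS //=; move: even_x; rewrite dx /= negbK.
have even_dom : covers (S :\: P) S.
  apply: coversI => x xS; rewrite !inE xS /= andbT negbK => odd_x; left.
  have xa : x != a by apply: contraTneq odd_x => ->; rewrite da.
  by rewrite ?inE nS //=; move: odd_x; rewrite dP //= andbT.
by have := Sm _ odd_dom; have := Sm _ even_dom; lia.
Qed.

(** Adding [v] to a cover of [S'] gives a cover of [S]. *)
Lemma needs_strip (S S' : {set G}) v m : needs S m.+1 ->
  (forall x, x \in S -> x \notin S' -> [\/ x = v, nxt x = v | nxt v = x]) ->
  needs S' m.
Proof.
move=> Sm SS' D /forall_inP DS'; suff: covers (v |: D) S.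
  by move/Sm; rewrite cardsU1; case: (v \in D); lia.
apply/forall_inP => x xS; rewrite in_setU1.
case: (eqVneq x v) => //= xv; case: (boolP (x \in S')) => [xS'|xS'].
  have := DS' x xS'; case: (x \in D) => //= /existsP[y /andP[yD xy]].
  by apply/existsP; exists y; rewrite !inE yD orbT.
apply/orP; right; apply/existsP; exists v; rewrite !inE eqxx /= adjE.
case: (SS' x xS xS') => /eqP; first by rewrite (negPf xv).
  by rewrite eq_sym => ->.
by rewrite eq_sym => ->; rewrite orbT.
Qed.

(* Otherwise two disjoint dominating sets would avoid [w]. *)
Lemma needs_pendant S m w : nxt_closed S -> needs S m -> (#|S| <= m.*2)%N ->
  w \in C -> exists2 x, x \in S :\: C & nxt x = w.
Proof.
move=> [CS nS] Sm S2m wC.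
case: (boolP [exists x in S :\: C, nxt x == w]) => [/existsP[x /andP[xS /eqP xw]]|no].
  by exists x.
have prevC v : v \in S -> nxt v = w -> v \in C.
  move=> vS vw; apply: contraR no => vC; apply/existsP.
  by exists v; rewrite in_setD vC vS vw eqxx.
have [d [dw dP even_nw]] := hitting_time adjE to_a nonbip wC.
have wS := subsetP CS w wC.
pose P := [set x in S | odd (d x)].
have SP : #|S :\ w| = (#|(S :\ w) :&: P| + #|(S :\ w) :\: P|)%N by rewrite cardsID.
have odd_dom : covers ((S :\ w) :&: P) S.
  apply: coversI => x xS; rewrite !inE xS andbT /=.
  case: (eqVneq x w) => [->|xw] /= even_x.
    have [z zC zw] := cyc_prev adjE to_a wC; right; exists z => //.
    have zNw : z != w by rewrite -zw eq_sym (nxt1 adjE).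
    by rewrite !inE zNw (subsetP CS) //= dP // zw dw.
  move: even_x; rewrite dP //= negbK => odd_nx; left.
  rewrite ?inE nS // odd_nx !andbT.
  by apply: contraTneq odd_nx => ->; rewrite dw.
have even_dom : covers ((S :\ w) :\: P) S.
  apply: coversI => x xS; rewrite !inE xS andbT /=.
  case: (eqVneq x w) => [->|xw] /=.
    by left; rewrite ?inE nS // (nxt1 adjE) even_nw.
  (* The vertex before [w] lies on the cycle and has lost its dominator [w]; its own predecessor, at
     distance 2 from [w], takes over. *)
  rewrite andbT negbK => odd_x; case: (eqVneq (nxt x) w) => [nxw|nxw].
    have [z zC zx] := cyc_prev adjE to_a (prevC _ xS nxw); right; exists z => //.
    have zNw : z != w by rewrite -nxw -zx eq_sym nxt2.
    rewrite !inE zNw (subsetP CS) //= dP // zx /=.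
    by rewrite negbK odd_x.
  by left; rewrite ?inE ?nxw nS //=; move: odd_x; rewrite dP //= andbT.
have := Sm _ odd_dom; have := Sm _ even_dom.
by have := cardsD1 w S; rewrite wS; lia.
Qed.

(* The list is read from the right: each pair hangs from the cycle or from
   first components that come later in the list. *)
Fixpoint comb (L : seq (G * G)) : bool :=
  if L is (x, y) :: L' then
    [&& (nxt x \in C) || (nxt x \in unzip1 L'),
        (nxt y \in C) || (nxt y \in x :: unzip1 L') & comb L']
  else true.

Fixpoint flat (L : seq (G * G)) : seq G :=
  if L is (x, y) :: L' then x :: y :: flat L' else [::].

Lemma comb_nxt L x : comb L -> x \in flat L ->
  (nxt x \in C) || (nxt x \in unzip1 L).
Proof.
elim: L => [//|[y z] L IHL] /= /and3P[cy cz cL].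
rewrite in_cons in_cons => /or3P[/eqP->|/eqP->|/(IHL cL)].
- by rewrite in_cons; case/orP: cy => ->; rewrite ?orbT.
- by [].
- by rewrite in_cons => /orP[] ->; rewrite ?orbT.
Qed.

Definition spans (s : seq G) (A : {set G}) := uniq s /\ s =i A.

Lemma spans_cons s (A : {set G}) x :
  spans s (A :\ x) -> x \in A -> spans (x :: s) A.
Proof.
move=> [us sA] xA; split=> [|y]; first by rewrite /= us sA !inE eqxx.
by rewrite !inE sA !inE; case: eqVneq => [->|].
Qed.

Lemma spans_perm s t A : perm_eq s t -> spans s A -> spans t A.
Proof.
move=> st [us sA]; split=> [|x]; first by rewrite -(perm_uniq st).
by rewrite -(perm_mem st).
Qed.

(** [Q] holds the vertices not yet paired. They are attached directly to the cycle, so any two of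
    them may form a pair at any time. *)
Definition combed (S : {set G}) L Q :=
  [/\ comb L, spans (Q ++ flat L) (S :\: C) & all (fun q => nxt q \in C) Q].

Lemma perm_pair x y (Q s : seq G) : perm_eq [:: x, y & Q ++ s] (Q ++ [:: x, y & s]).
Proof.
by rewrite -[x :: y :: s]/([:: x; y] ++ s) perm_sym perm_catCA.
Qed.

Lemma combed_pair S L Q x y : combed (S :\ x :\ y) L Q ->
  x \in S -> y \in S -> x \notin C -> y \notin C -> x != y ->
  (nxt x \in C) || (nxt x \in unzip1 L) ->
  (nxt y \in C) || (nxt y \in x :: unzip1 L) ->
  combed S ((x, y) :: L) Q.
Proof.
move=> [cL sL QC] xS yS xC yC xy px py; split=> //=; first by rewrite px py.
apply: (spans_perm (perm_pair x y Q (flat L))).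
have DE : (S :\ x :\ y) :\: C = (S :\: C) :\ x :\ y.
  by apply/setP => z; rewrite !inE; do !case: (_ == _); rewrite ?andbF.
rewrite DE in sL; apply: spans_cons; last by rewrite in_setD xC.
by apply: spans_cons => //; rewrite in_setD1 in_setD eq_sym xy yC.
Qed.

Lemma combed_use S L Q x y : combed S L [:: x, y & Q] -> combed S ((x, y) :: L) Q.
Proof.
move=> [cL sL /= /and3P[xC yC QC]]; split=> //=; first by rewrite xC yC.
exact: spans_perm (perm_pair _ _ _ _) sL.
Qed.

Lemma combed_reduce S L Q : combed S L Q -> exists L' Q',
  [/\ combed S L' Q', {subset unzip1 L <= unzip1 L'} & size Q' = odd (size Q)].
Proof.
have [n] := ubnP (size Q); elim: n Q L => // n IHn [|x [|y Q]] L Qn LQ.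
- by exists L, [::]; split.
- by exists L, [:: x]; split.
have [|L' [Q' [LQ' LL' sQ']]] := IHn Q _ _ (combed_use LQ); first by move: Qn => /=; lia.
exists L', Q'; split=> // [z zL|]; last by rewrite sQ' /= negbK.
by apply: LL'; rewrite inE zL orbT.
Qed.

Lemma size_combed (S : {set G}) L Q : C \subset S -> combed S L Q ->
  #|S| = (#|C| + size Q + (size L).*2)%N.
Proof.
move=> CS [_ [us sS] _].
have flat_size : size (flat L) = (size L).*2 by elim: (L) => //= -[x y] l /= ->.
have <- : #|S :&: C| = #|C| by rewrite (setIidPr CS).
rewrite -(cardsID C S) -addnA; congr addn.
by rewrite -(eq_card sS) (card_uniqP us) size_cat flat_size.
Qed.

(** Nothing hangs from a second component or from an element of [Q]; hence off the cycle a vertex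
    that is not a first component is a leaf. *)
Lemma combed_inner (S : {set G}) L Q x y : combed S L Q -> x \in S -> nxt x = y -> y \notin C ->
  y \in unzip1 L.
Proof.
move=> [cL [_ sS] /allP QC] xS xy yC.
have: x \in Q ++ flat L.
  by rewrite sS in_setD xS andbT; apply: contra yC => xC; rewrite -xy cyc_nxt.
rewrite mem_cat => /orP[/QC|/(comb_nxt cL)]; rewrite xy (negPf yC) //.
Qed.

(** If some [u] and [nxt u] are both off the cycle, such a [u] farthest from [a] is taken, and [v]
    is [nxt u]: all predecessors of [v] are then leaves. *)
Lemma deepest S : nxt_closed S ->
  (forall x, x \in S :\: C -> nxt x \in C) \/
  exists2 v, v \in S :\: C & exists2 u, (u \in S) && (nxt u == v) &
    forall x y, x \in S -> nxt x = v -> y \in S -> nxt y != x.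
Proof.
move=> [CS nS]; pose P x := [&& x \in S, x \notin C & nxt x \notin C].
case: (pickP P) => [u0 Pu0|noP]; last first.
  left=> x; rewrite inE => /andP[xC xS].
  by apply: contraFT (noP x) => nxC; apply/and3P.
right; have [d [da dP _]] := hitting_time adjE to_a nonbip (cyc_root to_a).
have dC x : x \notin C -> d x = (d (nxt x)).+1.
  by move=> xC; apply: dP; apply: contraNneq xC => ->; apply: cyc_root to_a.
case: (arg_maxnP d Pu0) => u /and3P[uS uC vC] umax.
exists (nxt u); first by rewrite inE nS // andbT.
exists u; first by rewrite uS eqxx.
move=> x y xS xv yS; apply/eqP => yx.
have xC : x \notin C by apply: contra vC => /(cyc_nxt); rewrite xv.
have yC : y \notin C by apply: contra xC => /(cyc_nxt); rewrite yx.
have: P y by apply/and3P; split; rewrite ?yx.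
by move/umax; rewrite (dC y) // yx (dC x) // xv -(dC u) //; lia.
Qed.

Lemma closed_strip (S : {set G}) (X : {set G}) : nxt_closed S ->
  [disjoint X & C] -> (forall x y, y \in S -> y \notin X -> nxt y = x -> x \notin X) ->
  nxt_closed (S :\: X).
Proof.
move=> [CS nS] XC Xup; split.
  by rewrite subsetD CS disjoint_sym.
move=> y; rewrite !inE => /andP[yX yS]; rewrite nS // andbT.
exact: Xup (erefl _).
Qed.

End Domination.

(** * Arranging the forest into pairs *)

Section Pairing.
Variables (G : sgraph) (nxt : G -> G) (a : G).
Hypothesis adjE : forall x y, adj x y = (y == nxt x) || (x == nxt y).
Hypothesis nxt2 : forall x, nxt (nxt x) != x.
Hypothesis to_a : forall x, fconnect nxt x a.
Hypothesis nonbip : ~ bipartite G.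
Local Notation C := (cyc nxt a).
Local Notation combed := (combed nxt a).
Local Notation nxt_closed := (nxt_closed nxt a).

Lemma combed_hang S L w q : combed (S :\ w) L [:: q] ->
  w \in S -> w \notin C -> (nxt w \in C) || (nxt w \in unzip1 L) ->
  combed S ((w, q) :: L) [::].
Proof.
move=> [cL sL /= /andP[qC _]] wS wC wL; split=> //=; first by rewrite wL qC.
apply: spans_cons; last by rewrite in_setD wC.
suff -> : (S :\: C) :\ w = S :\ w :\: C by [].
by rewrite !setDDl setUC.
Qed.

Lemma spans_enum (A : {set G}) : spans (enum A) A.
Proof. by split=> [|x]; rewrite ?enum_uniq ?mem_enum. Qed.

Lemma combed_shallow S : (forall x, x \in S :\: C -> nxt x \in C) ->
  combed S [::] (enum (S :\: C)).
Proof.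
move=> SC; split=> //; first by rewrite cats0; apply: spans_enum.
by apply/allP => x; rewrite mem_enum; apply: SC.
Qed.

(** * Stripping a vertex together with the leaves attached to it *)

Section Strip.
Variables (S : {set G}) (v : G).
Hypotheses (Scl : nxt_closed S) (vS : v \in S :\: C).
Hypothesis no_grandchild :
  forall x y, x \in S -> nxt x = v -> y \in S -> nxt y != x.

Let X := [set x in S | nxt x == v].
Let S' := S :\: (v |: X).

Lemma strip_notin_cyc x : x \in X -> x \notin C.
Proof.
rewrite inE => /andP[_ /eqP xv]; move: vS; rewrite in_setD => /andP[vC _].
by apply: contra vC => /cyc_nxt; rewrite xv.
Qed.

Lemma strip_card : #|S| = (#|S'| + #|X|).+1.
Proof.
have vX : v \notin X by rewrite inE (negPf (nxt1 adjE v)) andbF.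
have sub : v |: X \subset S.
  rewrite subUset sub1set; move: vS; rewrite in_setD => /andP[_ ->] /=.
  by apply/subsetP => x; rewrite inE => /andP[].
rewrite -(cardsID (v |: X) S) (setIidPr sub) cardsU1 vX /S' /=; lia.
Qed.

Lemma strip_closed : nxt_closed S'.
Proof.
have [CS nS] := Scl.
apply: closed_strip => // [|x y yS yX <-].
  rewrite disjoint_subset; apply/subsetP => x xX.
  suff: x \notin C by [].
  move: xX; rewrite in_setU1 => /orP[/eqP->|]; last exact: strip_notin_cyc.
  by move: vS; rewrite in_setD => /andP[].
move: yX; rewrite in_setU1 inE yS negb_or /= => /andP[yv nyv].
rewrite in_setU1 inE (negPf nyv) /= negb_and nS //=.
by apply/eqP => nny; have := no_grandchild (nS _ yS) nny yS; rewrite eqxx.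
Qed.

Lemma strip_needs m : needs S m.+1 -> needs S' m.
Proof.
move=> Sm; apply: (needs_strip adjE (v := v) Sm) => x xS.
rewrite in_setD xS andbT negbK in_setU1 inE xS /= => /orP[]/eqP->.
  by constructor 1.
by constructor 2.
Qed.

Lemma strip_parent : nxt v \in S'.
Proof.
have [_ nS] := Scl; move: vS; rewrite in_setD => /andP[_ vS'].
by rewrite in_setD in_setU1 inE !negb_or nS // (nxt1 adjE) nxt2.
Qed.

Lemma strip_leaf L Q w : combed S' L Q -> w \in S' ->
  ~~ ((w \in C) || (w \in unzip1 L)) ->
  nxt_closed (S' :\ w) /\ #|S'| = #|S' :\ w|.+1.
Proof.
move=> LQ wS; rewrite negb_or => /andP[wC wL].
split; last by rewrite (cardsD1 w) wS.
apply: closed_strip strip_closed _ _ => [|x y yS _ <-].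
  by rewrite disjoints1.
rewrite in_set1; apply: contra wL => /eqP yw.
exact: (combed_inner LQ yS yw).
Qed.

(** The parent of [v] is dominated by [v] as well, so removing it too costs no further dominating
    vertex. *)
Lemma strip_leaf_needs m : needs S m.+1 -> needs (S' :\ nxt v) m.
Proof.
move=> Sm; apply: (needs_strip adjE (v := v) Sm) => x xS.
rewrite in_setD1 in_setD xS andbT in_setU1 inE xS negb_and !negbK /=.
by case/or3P=> /eqP->; [constructor 3 | constructor 1 | constructor 2].
Qed.

End Strip.

(* In the second part, the spare elements of [Q] make room for a further pair
   hanging from [w], even when [w] is a leaf. *)
Lemma even_combed S m : nxt_closed S -> needs S m -> #|S| = m.*2 ->
  (exists L Q, combed S L Q /\ (2 < size Q)%N) /\
  (forall w, w \in S -> exists L Q,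
     [/\ combed S L Q, (0 < size Q)%N & (w \in C) || (w \in unzip1 L)]).
Proof.
have [_ C2] := card_cyc adjE to_a nonbip.
elim: m S => [|m IHm] S Scl Sm S2m.
  by have := subset_leq_card (proj1 Scl); lia.
have [shallow|[v vS [u /andP[uS /eqP uv] deep]]] := deepest adjE to_a nonbip Scl.
  have SQ := combed_shallow shallow.
  (* By [needs_pendant] each cycle vertex carries a pendant vertex, so at least three vertices are
     unpaired. *)
  have sQ : (#|C| <= size (enum (S :\: C)))%N.
    rewrite -cardE; apply: leq_trans (leq_imset_card nxt _).
    apply/subset_leq_card/subsetP => w wC.
    have [|x xS <-] := needs_pendant adjE nxt2 to_a nonbip Scl Sm _ wC.
      by rewrite S2m.
    exact: imset_f.
  split=> [|w wS]; first by exists [::], (enum (S :\: C)); split=> //; lia.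
  case: (boolP (w \in C)) => wC; first by exists [::], (enum (S :\: C)); split=> //; lia.
  have wSC : w \in S :\: C by rewrite in_setD wC.
  have := cardsD1 w (S :\: C); rewrite wSC.
  have := spans_enum (S :\: C :\ w); move: SQ sQ; rewrite -!cardE => -[_ _ QC] sQ.
  case E: (enum (S :\: C :\ w)) => [|q Q] sp.
    by move/eqP: E; rewrite -size_eq0 -cardE => /eqP; lia.
  have := congr1 size E; rewrite -cardE /= => -> sSC.
  exists [:: (w, q)], Q; split; [|by lia|by rewrite /= mem_head ?orbT].
  apply: combed_use; split=> //; first by rewrite cats0; apply: spans_cons.
  apply/allP => x; have [_ /(_ x)] := spans_cons sp wSC; rewrite inE => ->.
  exact: shallow.
set X := [set x in S | nxt x == v]; pose S' := S :\: (v |: X).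
have cS : #|S| = (#|S'| + #|X|).+1 := strip_card vS.
have S'cl : nxt_closed S' := strip_closed Scl vS deep.
have S'm : needs S' m := strip_needs Sm.
have uX : u \in X by rewrite inE uS uv eqxx.
(* By [needs_half], [S'] keeps at least 2m of the 2m + 2 vertices, which leaves room for [v] and a
   single leaf. *)
have X1 : X = [set u].
  apply/esym/eqP; rewrite eqEcard sub1set uX cards1.
  by have := needs_half adjE to_a nonbip S'cl S'm; lia.
have S'E : S' = S :\ v :\ u by rewrite /S' X1 setDDl.
rewrite X1 cards1 in cS.
(* Otherwise the parent of [v] would be a leaf of [S'], and removing it would leave fewer vertices
   than [needs_half] allows. *)
have nv L Q : combed S' L Q -> (nxt v \in C) || (nxt v \in unzip1 L).
  move=> LQ; apply: contraT => nvL.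
  have [wcl wc] := strip_leaf Scl vS deep LQ (strip_parent Scl vS) nvL.
  have := needs_half adjE to_a nonbip wcl (strip_leaf_needs Sm).
  by move: wc; rewrite -/S'; lia.
have [uC vC] : u \notin C /\ v \notin C.
  by rewrite (strip_notin_cyc vS uX); move: vS; rewrite in_setD => /andP[].
have vS1 : v \in S by move: vS; rewrite in_setD => /andP[].
have vu : v != u by rewrite -uv (nxt1 adjE).
have add L Q : combed S' L Q -> combed S ((v, u) :: L) Q.
  move=> LQ; have nvL := nv _ _ LQ; rewrite S'E in LQ.
  by apply: combed_pair => //; rewrite uv mem_head orbT.
have [|[L1 [Q1 [LQ1 sQ1]]] IH2] := IHm S' S'cl S'm; first by lia.
split=> [|w wS]; first by exists ((v, u) :: L1), Q1; split; [apply: add|].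
case: (eqVneq w v) => [->|wv].
  exists ((v, u) :: L1), Q1; split; [exact: add | by lia |].
  by rewrite /= mem_head orbT.
case: (eqVneq w u) => [->|wu]; last first.
  have [|L2 [Q2 [LQ2 sQ2 wL2]]] := IH2 w; first by rewrite S'E !inE wv wu.
  exists ((v, u) :: L2), Q2; split; [exact: add | by [] |].
  by case/orP: wL2 => [->//|wL2]; rewrite /= in_cons wL2 !orbT.
have nvL := nv _ _ LQ1; have [cL sL QC] := add _ _ LQ1.
case: Q1 {LQ1} sQ1 sL QC => [|q1 [|q2 Q1]] //= sQ1 sL /and3P[q1C q2C QC].
(* To make the leaf [u] a first component, the pair [(v, u)] is split into [(v, q1)] and [(u, q2)],
   at the expense of two spare vertices. *)
exists [:: (u, q2), (v, q1) & L1], Q1; split; [|exact: sQ1|by rewrite /= mem_head ?orbT].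
split=> //.
  by move: cL => /= /and3P[_ _ cL]; rewrite uv q1C q2C mem_head nvL cL orbT.
by apply: spans_perm sL; apply/permP => P; rewrite /= !count_cat /=; clear; lia.
Qed.

(** Since [S] is even and the cycle odd, pairing the spare vertices leaves exactly one. *)
Lemma even_combed1 S m w : nxt_closed S -> needs S m -> #|S| = m.*2 -> w \in S ->
  exists L q, combed S L [:: q] /\ (w \in C) || (w \in unzip1 L).
Proof.
move=> Scl Sm S2m wS; have [_ /(_ w wS)[L [Q [LQ _ wL]]]] := even_combed Scl Sm S2m.
have [L' [Q' [LQ' LL' sQ']]] := combed_reduce LQ.
have [oC _] := card_cyc adjE to_a nonbip.
have := size_combed (proj1 Scl) LQ; rewrite S2m => sQ.
have {}sQ : odd (size Q) by move/(congr1 odd): sQ; rewrite !oddD !odd_double oC; case: odd.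
rewrite sQ in sQ'; case: Q' sQ' LQ' => [|q []] // _ LQ'.
by exists L', q; split=> //; case/orP: wL => [->//|/LL'->]; rewrite orbT.
Qed.

(** The set exceeds the tight size by one, so [v] has one or two leaves. If two, the rest is tight:
    its spare vertex is paired with [v], and the two leaves with each other. *)
Lemma odd_combed S m : nxt_closed S -> needs S m -> #|S| = m.*2.+1 ->
  exists L, combed S L [::].
Proof.
have [oC C2] := card_cyc adjE to_a nonbip.
elim: m S => [|m IHm] S Scl Sm S2m.
  by have := subset_leq_card (proj1 Scl); lia.
have [shallow|[v vS [u /andP[uS /eqP uv] deep]]] := deepest adjE to_a nonbip Scl.
  have SQ := combed_shallow shallow.
  have [L [Q [LQ _]]] := combed_reduce SQ.
  have := size_combed (proj1 Scl) SQ; rewrite S2m; move: (size (enum _)) => s sE.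
  have -> : odd s = false by move/(congr1 odd): sE; rewrite !oddD /= !odd_double oC; case: odd.
  by case: Q LQ => // LQ _; exists L.
set X := [set x in S | nxt x == v]; pose S' := S :\: (v |: X).
have cS : #|S| = (#|S'| + #|X|).+1 := strip_card vS.
have S'cl : nxt_closed S' := strip_closed Scl vS deep.
have S'm : needs S' m := strip_needs Sm.
have uX : u \in X by rewrite inE uS uv eqxx.
have [uC vC] : u \notin C /\ v \notin C.
  by rewrite (strip_notin_cyc vS uX); move: vS; rewrite in_setD => /andP[].
have vS1 : v \in S by move: vS; rewrite in_setD => /andP[].
have vNX x : x \in X -> v != x.
  by rewrite inE => /andP[_ /eqP <-]; rewrite (nxt1 adjE).
have vu := vNX u uX.
have nvS' : nxt v \in S' := strip_parent Scl vS.
have half := needs_half adjE to_a nonbip S'cl S'm.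
case: (eqVneq (X :\ u) set0) => [X1|/set0Pn[u' u'X]].
  have {}X1 : X = [set u] by rewrite -(setD1K uX) X1 setU0.
  have S'E : S' = S :\ v :\ u by rewrite /S' X1 setDDl.
  rewrite X1 cards1 in cS.
  have add L : combed S' L [::] -> (nxt v \in C) || (nxt v \in unzip1 L) ->
      combed S ((v, u) :: L) [::].
    rewrite S'E => LQ nvL.
    by apply: combed_pair => //; rewrite uv mem_head orbT.
  have [|L LQ] := IHm S' S'cl S'm; first by move: cS S2m; clear; lia.
  case: (boolP ((nxt v \in C) || (nxt v \in unzip1 L))) => [nvL|nvL].
    by exists ((v, u) :: L); apply: add.
  (* Here [nxt v] is a leaf of [S']; without it the set is tight, and the spare vertex [q] becomes
     the partner of [nxt v]. *)
  have [wcl wc] := strip_leaf Scl vS deep LQ nvS' nvL.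
  have wS' : nxt (nxt v) \in S' :\ nxt v.
    by rewrite in_setD1 (nxt1 adjE) (proj2 S'cl).
  have [|L2 [q [LQ2 wL2]]] := even_combed1 wcl (strip_leaf_needs Sm) _ wS'.
    by move: wc cS S2m; rewrite -/S'; clear; lia.
  exists [:: (v, u), (nxt v, q) & L2]; apply: add; last by rewrite /= mem_head orbT.
  by apply: combed_hang => //; move: nvL; rewrite negb_or => /andP[].
have := cardsD1 u X; rewrite uX; have := cardsD1 u' (X :\ u); rewrite u'X.
move=> cX2 cX1; have [cX X0] : #|X| = 2 /\ #|X :\ u :\ u'| = 0.
  by move: cX1 cX2 cS S2m half; clear; lia.
have X2 : X = [set u; u'].
  have /eqP Xuu' : X :\ u :\ u' == set0 by rewrite -cards_eq0 X0.
  by rewrite -(setD1K uX) -(setD1K u'X) Xuu' setU0.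
move: u'X; rewrite in_setD1 => /andP[u'u u'X].
have S'E : S' = S :\ u :\ u' :\ v by apply/setP => z; rewrite /S' X2 !inE; do 3!case: (z == _).
have [|L [q [LQ wL]]] := even_combed1 S'cl S'm _ nvS'.
  by move: cS S2m; rewrite cX; clear; lia.
have [u'S /eqP u'v] : u' \in S /\ nxt u' == v.
  by move: u'X; rewrite inE => /andP.
exists [:: (u, u'), (v, q) & L].
apply: combed_pair => //; last 3 first.
- by rewrite eq_sym.
- by rewrite uv mem_head orbT.
- by rewrite u'v /= !in_cons eqxx !orbT.
- by apply: combed_hang; rewrite -?S'E // !in_setD1 (vNX u') // vu.
- exact: (strip_notin_cyc vS u'X).
Qed.

End Pairing.

Import Order.TTheory GRing.Theory Num.Theory.
Local Open Scope ring_scope.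

(** * Rayleigh quotients *)

(** Over the complex numbers [A] is unitarily diagonalizable. In the coordinates [w] both sides are
    weighted sums of the |w_i|^2, and the diagonal entries are real eigenvalues of [A], hence at
    least [m]. *)
Lemma rayleigh_ge (R : rcfType) n (A : 'M[R]_n) (m : R) (v : 'rV[R]_n) :
  A^T = A -> (forall a, eigenvalue A a -> m <= a) ->
  m * (v *m v^T) 0 0 <= (v *m A *m v^T) 0 0.
Proof.
move=> symA mA; pose toC := map_mx (real_complex R); pose AC := toC _ _ A.
have realC k l (B : 'M[R]_(k, l)) : map_mx Num.conj (toC _ _ B) = toC _ _ B.
  by apply/matrixP => i j; rewrite !mxE conj_Creal ?complex_real.
have AC_herm : AC \is hermsymmx.
  apply: realsym_hermsym; last by apply/mxOverP => i j; rewrite mxE complex_real.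
  by apply/is_hermitianmxP; rewrite expr0 scale1r map_mx_id // map_trmx symA.
have /orthomx_spectralP AE := hermitian_normalmx AC_herm.
have dR := hermitian_spectral_diag_real AC_herm.
move: AE (spectral_unitarymx AC) dR.
move: (spectralmx AC) (spectral_diag AC) => P d AE Pu dR.
have Punit := unitarymx_unit Pu.
have PA : P *m AC = diag_mx d *m P by rewrite AE !mulmxA mulmxV // mul1mx.
have dge i : (m%:C)%C <= d 0 i.
  have /RRe_real dE : d 0 i \is Num.real by apply: (mxOverP dR).
  rewrite -dE lecR; apply: mA.
  have := eigenvalue_map (real_complex R) A (complex.Re (d 0 i)).
  rewrite [X in eigenvalue _ X]dE => <-.
  apply/eigenvalueP; exists (row i P); last first.
    apply/eqP => /(congr1 (mulmx^~ (invmx P))).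
    rewrite -row_mul mulmxV // mul0mx => /rowP/(_ i)/eqP.
    by rewrite !mxE eqxx oner_eq0.
  by rewrite -row_mul PA row_mul row_diag_mx -scalemxAl -rowE.
pose w := toC _ _ v *m invmx P.
have vw : toC _ _ v = w *m P by rewrite /w mulmxKV.
have vTw : (toC _ _ v)^T = invmx P *m map_mx Num.conj w^T.
  rewrite -[in LHS]realC vw map_mxM trmx_mul invmx_unitary //.
  by rewrite !map_trmx.
have wE (D : 'rV_n) : (w *m diag_mx D *m map_mx Num.conj w^T) 0 0 =
    \sum_i D 0 i * `|w 0 i| ^+ 2.
  rewrite !mxE; apply: eq_bigr => i _; rewrite mul_mx_diag !mxE normCK.
  by rewrite mulrAC mulrC.
have vvE : ((v *m v^T) 0 0)%:C%C = \sum_i `|w 0 i| ^+ 2.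
  transitivity ((toC _ _ v *m (toC _ _ v)^T) 0 0).
    by rewrite /toC map_trmx -map_mxM [RHS]mxE.
  rewrite vTw vw mulmxA mulmxK //.
  have := wE (const_mx 1); rewrite diag_const_mx mulmx1 => ->.
  by apply: eq_bigr => i _; rewrite mxE mul1r.
have vAvE : ((v *m A *m v^T) 0 0)%:C%C = \sum_i d 0 i * `|w 0 i| ^+ 2.
  transitivity ((toC _ _ v *m AC *m (toC _ _ v)^T) 0 0).
    by rewrite /toC /AC map_trmx -!map_mxM [RHS]mxE.
  by rewrite vTw vw AE !mulmxA mulmxK // mulmxK // wE.
rewrite -lecR rmorphM /= vvE vAvE mulr_sumr; apply: ler_sum => i _.
by rewrite ler_wpM2r ?exprn_ge0.
Qed.

(** * The signless quadratic form of a functional graph *)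

Section FunctionalGraph.
Variables (R : realType) (G : sgraph) (nxt : G -> G).
Hypothesis adjE : forall x y, adj x y = (y == nxt x) || (x == nxt y).
Hypothesis nxt2 : forall x, nxt (nxt x) != x.

Definition energy (f : G -> R) := \sum_x (f x + f (nxt x)) ^+ 2.

Lemma adj_natE x y : (adj x y)%:R = (y == nxt x)%:R + (x == nxt y)%:R :> R.
Proof.
rewrite adjE; case: eqP => [->|_]; last by rewrite add0r.
by rewrite [x == _]eq_sym (negPf (nxt2 x)) addr0.
Qed.

(** The left side depends on adjacency only, which lets the energy be carried along an
    isomorphism. *)
Lemma energyE (f : G -> R) :
  \sum_x \sum_y (adj x y)%:R * (f x ^+ 2 + f x * f y) = energy f.
Proof.
have pick (F : G -> R) z : \sum_y (y == z)%:R * F y = F z.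
  rewrite (bigD1 z) //= eqxx mul1r big1 ?addr0 // => y /negPf->.
  by rewrite mul0r.
transitivity (\sum_x \sum_y (y == nxt x)%:R * (f x ^+ 2 + f x * f y) +
    \sum_x \sum_y (x == nxt y)%:R * (f x ^+ 2 + f x * f y)).
  rewrite -big_split /=; apply: eq_bigr => x _; rewrite -big_split /=.
  by apply: eq_bigr => y _; rewrite adj_natE mulrDl.
rewrite [X in _ + X]exchange_big /= -big_split /=; apply: eq_bigr => x _.
by rewrite !pick; ring.
Qed.

Lemma quadratic_formE (f : G -> R) (v := \row_i f (enum_val i)) :
  (v *m signless_laplacian R G *m v^T) 0 0 = energy f /\
  (v *m v^T) 0 0 = \sum_x f x ^+ 2.
Proof.
have bij : {on predT, bijective (@enum_val G predT)}.
  exact: onW_bij (@enum_val_bij G).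
have reE (F : G -> R) : \sum_x F x = \sum_(i < #|G|) F (enum_val i).
  by rewrite (reindex _ bij).
split; last first.
  by rewrite !mxE reE; apply: eq_bigr => i _; rewrite !mxE expr2.
rewrite -energyE -mulmxA !mxE reE; apply: eq_bigr => i _.
under [RHS]eq_bigr => j _ do rewrite mulrDr.
rewrite big_split /= [X in _ + X]reE mulmxDl mul_diag_mx !mxE mulrDr; congr (_ + _).
  rewrite -mulr_suml mulrCA -expr2; congr (_ * _).
  rewrite /degree -sum1_card natr_sum big_mkcond /=; apply: eq_bigr => y _.
  by rewrite inE; case: adj.
by rewrite mulr_sumr; apply: eq_bigr => j _; rewrite !mxE; ring.
Qed.

Lemma q_min_le (f : G -> R) : (0 < #|G|)%N ->
  q_min R G * (\sum_x f x ^+ 2) <= energy f.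
Proof.
move=> G0; have [Ef Nf] := quadratic_formE f.
rewrite -Ef -Nf; apply: rayleigh_ge; first exact: tr_signless_laplacian.
by have [] := q_minP R G0.
Qed.

Lemma q_min_attained : (0 < #|G|)%N ->
  exists2 f : G -> R, (exists x, f x != 0) &
    energy f = q_min R G * (\sum_x f x ^+ 2).
Proof.
move=> G0; have [/eigenvalueP[v vQ v0] _] := q_minP R G0.
pose f x := v 0 (enum_rank x).
have vE : v = \row_i f (enum_val i).
  by apply/rowP => i; rewrite mxE /f enum_valK.
exists f.
  have /rV0Pn[i vi] := v0.
  by exists (enum_val i); rewrite /f enum_valK.
have [<- <-] := quadratic_formE f.
by rewrite -vE vQ -scalemxAl mxE.
Qed.

End FunctionalGraph.

(** * The quadratic form of a comb hanging from a triangle *)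

(** First-order condition, used to read stationarity off a Rayleigh bound. At e = -b / (|c| + 1) the
    quadratic is negative unless b = 0. *)
Lemma linear_term0 (R : realFieldType) (b c : R) :
  (forall e, 0 <= 2 * b * e + c * e ^+ 2) -> b = 0.
Proof.
move=> bc; apply/eqP; apply: contraT => b0.
have d0 : 0 < `|c| + 1 by rewrite ltr_pwDr.
have := bc (- b / (`|c| + 1)).
have -> : 2 * b * (- b / (`|c| + 1)) + c * (- b / (`|c| + 1)) ^+ 2 =
    (b / (`|c| + 1)) ^+ 2 * (c - 2 * (`|c| + 1)).
  by field; rewrite gt_eqF.
rewrite pmulr_rge0; last by rewrite exprn_even_gt0 //= mulf_neq0 // invr_neq0 // gt_eqF.
by have := ler_norm c; have := normr_ge0 c; lra.
Qed.

Section Comb.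
Variable R : realFieldType.
Implicit Types (M : R) (D : seq (R * R)).

(* [D] lists the differences (dx, dp) along the teeth of a comb, the farthest
   tooth first: the backbone starts at the value [M] and grows by dx at each
   tooth, whose pendant vertex exceeds it by dp. *)
Fixpoint top M D : R := if D is (dx, _) :: D' then top M D' + dx else M.

Fixpoint norm2 M D : R :=
  if D is (_, dp) :: D'
  then norm2 M D' + top M D ^+ 2 + (top M D + dp) ^+ 2 else 0.

Fixpoint cost D : R :=
  if D is (dx, dp) :: D' then cost D' + dx ^+ 2 + dp ^+ 2 else 0.

(** Half the derivative of [norm2] with respect to [M]. *)
Fixpoint mass M D : R :=
  if D is (_, dp) :: D'
  then mass M D' + top M D + (top M D + dp) else 0.

Definition nneg D := all (fun d => (0 <= d.1) && (0 <= d.2)) D.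

Lemma top_cat M D1 D2 : top M (D1 ++ D2) = top (top M D2) D1.
Proof. by elim: D1 => //= -[dx dp] D1 ->. Qed.

Lemma norm2_cat M D1 D2 :
  norm2 M (D1 ++ D2) = norm2 M D2 + norm2 (top M D2) D1.
Proof.
by elim: D1 => [|[dx dp] D1 IH] /=; rewrite ?addr0 // IH top_cat !addrA.
Qed.

Lemma cost_cat D1 D2 : cost (D1 ++ D2) = cost D1 + cost D2.
Proof. by elim: D1 => [|[dx dp] D1 IH] /=; rewrite ?add0r // IH; ring. Qed.

Lemma top_shift M D e : top (M + e) D = top M D + e.
Proof. by elim: D => //= -[dx dp] D ->; ring. Qed.

Lemma top_ge M D : nneg D -> M <= top M D.
Proof. by elim: D => //= -[dx dp] D IH /= /andP[/andP[dx0 _] /IH]; lra. Qed.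

Lemma norm2_ge0 M D : 0 <= norm2 M D.
Proof. by elim: D => //= -[dx dp] D IH /=; rewrite !addr_ge0 ?sqr_ge0. Qed.

Lemma mass_ge0 M D : 0 <= M -> nneg D -> 0 <= mass M D.
Proof.
move=> M0; elim: D => //= -[dx dp] D IH /= /andP[/andP[dx0 dp0] D0].
by have := IH D0; have := top_ge M D0; lra.
Qed.

Lemma norm2_shift M D e : 0 <= e ->
  norm2 M D + 2 * e * mass M D <= norm2 (M + e) D.
Proof.
move=> e0; elim: D => [|[dx dp] D IH] /=; first by lra.
rewrite top_shift; have := sqr_ge0 e; move: (top M D) IH => T IH.
have -> : (T + e + dx) ^+ 2 = (T + dx) ^+ 2 + 2 * e * (T + dx) + e ^+ 2 by ring.
have -> : (T + e + dx + dp) ^+ 2 =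
    (T + dx + dp) ^+ 2 + 2 * e * (T + dx + dp) + e ^+ 2 by ring.
lra.
Qed.

Lemma norm2_mono M M' D : 0 <= M -> M <= M' -> nneg D -> norm2 M D <= norm2 M' D.
Proof.
move=> M0 MM' D0; have e0 : 0 <= M' - M by lra.
have := norm2_shift M D e0; have -> : M + (M' - M) = M' by ring.
by have := mulr_ge0 e0 (mass_ge0 M0 D0); lra.
Qed.

Lemma mass0_norm2 M D : 0 <= M -> nneg D -> mass M D <= 0 -> norm2 M D = 0.
Proof.
move=> M0; elim: D => //= -[dx dp] D IH /= /andP[/andP[dx0 dp0] D0] m0.
have mD := mass_ge0 M0 D0; have tD := top_ge M D0.
rewrite IH ?add0r //; last by lra.
have -> : top M D + dx = 0 by lra.
have -> : dp = 0 by lra.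
by rewrite addr0 expr0n /= addr0.
Qed.

(* The Rayleigh bound on a triangle with a comb of [k] teeth at its third vertex,
   once the signs have been switched so that only the edge between the first two
   vertices keeps a plus. *)
Definition comb_bound (q : R) (k : nat) := forall v0 v1 M D, size D = k ->
  q * (v0 ^+ 2 + v1 ^+ 2 + M ^+ 2 + norm2 M D) <=
  (v0 + v1) ^+ 2 + (M - v0) ^+ 2 + (M - v1) ^+ 2 + cost D.

Definition comb_extremal (q : R) v0 v1 M D :=
  q * (v0 ^+ 2 + v1 ^+ 2 + M ^+ 2 + norm2 M D) =
  (v0 + v1) ^+ 2 + (M - v0) ^+ 2 + (M - v1) ^+ 2 + cost D.

Section Extremal.
Variables (q : R) (k : nat).
Hypothesis (q_gt0 : 0 < q) (qP : comb_bound q k).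
Variables (v0 v1 M : R) (D : seq (R * R)).
Hypotheses (sizeD : size D = k) (D_ge0 : nneg D) (extD : comb_extremal q v0 v1 M D).

(** Testing the bound on [D'] yields 2 q e M <= e^2. *)
Lemma extremal_step D' e : size D' = k -> 0 < M -> 0 < e ->
  norm2 M D + 2 * e * M <= norm2 M D' -> cost D' <= cost D + e ^+ 2 -> 2 * q * M <= e.
Proof.
move=> sD' M0 e0 N E; have := qP v0 v1 M sD'; have := extD; rewrite /comb_extremal.
have := ler_wpM2l (ltW q_gt0) N.
by move=> qN ext bnd; rewrite -(ler_pM2l e0); lra.
Qed.

(** Raising a zero difference by [e] costs only e^2, while the norm grows by at least 2 e M because
    all values are at least [M]. Taking e = q M contradicts [extremal_step]. *)
Lemma extremal_gt0 : 0 < M -> all (fun d => (0 < d.1) && (0 < d.2)) D.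
Proof.
move=> M0; apply/allP => -[dx dp] /= dD.
have [D1 [D2 DE]] : exists D1 D2, D = D1 ++ (dx, dp) :: D2.
  by case/splitPr: dD => D1 D2; exists D1, D2.
move: D_ge0; rewrite /nneg DE all_cat /= => /and3P[D1_ge0 /andP[dx0 dp0] D2_ge0].
have qM : 0 < q * M by rewrite mulr_gt0.
have T := top_ge M D2_ge0.
have mono e1 e2 : 0 <= e1 -> 0 <= e2 ->
  norm2 M D + 2 * (e1 + e2) * M <= norm2 M (D1 ++ (dx + e1, dp + e2) :: D2).
  move=> e10 e20; rewrite DE !norm2_cat /=.
  have : norm2 (top M D2 + dx) D1 <= norm2 (top M D2 + (dx + e1)) D1.
    by apply: norm2_mono => //; lra.
  move: (top M D2) T => t T; have te1 : 0 <= e1 * (t - M) by rewrite mulr_ge0 //; lra.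
  have te2 : 0 <= e2 * (t - M) by rewrite mulr_ge0 //; lra.
  have := mulr_ge0 e10 dx0; have := mulr_ge0 e10 dp0; have := mulr_ge0 e20 dx0.
  have := mulr_ge0 e20 dp0; have := mulr_ge0 e10 e20.
  have := sqr_ge0 e1; have := sqr_ge0 e2; have := mulr_ge0 e10 (ltW M0).
  have -> : (t + (dx + e1)) ^+ 2 = (t + dx) ^+ 2 + 2 * e1 * (t - M)
    + 2 * e1 * M + 2 * (e1 * dx) + e1 ^+ 2 by ring.
  have -> : (t + (dx + e1) + (dp + e2)) ^+ 2 = (t + dx + dp) ^+ 2
    + 2 * e1 * (t - M) + 2 * e1 * M + 2 * e2 * (t - M) + 2 * e2 * M
    + 2 * (e1 * dx) + 2 * (e1 * dp) + 2 * (e2 * dx) + 2 * (e2 * dp)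
    + 2 * (e1 * e2) + e1 ^+ 2 + e2 ^+ 2 by ring.
  lra.
have sz x : size (D1 ++ x :: D2) = k by rewrite -sizeD DE !size_cat.
apply/andP; split; rewrite lt_neqAle ?dx0 ?dp0 andbT; apply/eqP => d0.
  have := @extremal_step (D1 ++ (dx + q * M, dp + 0) :: D2) (q * M) (sz _) M0 qM.
  have := mono (q * M) 0 (ltW qM) (lexx 0); rewrite addr0 => -> /(_ isT).
  by rewrite DE !cost_cat /= -d0; lra.
have := @extremal_step (D1 ++ (dx + 0, dp + q * M) :: D2) (q * M) (sz _) M0 qM.
have := mono 0 (q * M) (lexx 0) (ltW qM); rewrite add0r => -> /(_ isT).
by rewrite DE !cost_cat /= -d0; lra.
Qed.

(** Stationarity at the farthest pendant vertex, whose value is [P], reads dp = q P, and dp < P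
    since M > 0. *)
Lemma extremal_lt1 : 0 < M -> (0 < k)%N -> q < 1.
Proof.
move=> M0 k0; have := extremal_gt0 M0; move: D_ge0 (extD) sizeD.
case: D => [|[dx dp] D'] /=; first by move=> _ _ kE; rewrite -kE in k0.
case/andP=> /andP[dx0 dp0] D'0 ext sz /andP[/andP[dx1 dp1] _].
have T := top_ge M D'0; set P := top M D' + dx + dp.
have: dp - q * P = 0.
  apply: (@linear_term0 _ _ (1 - q)) => e.
  have := qP v0 v1 M (D := (dx, dp + e) :: D') sz; move: ext.
  rewrite /comb_extremal /= -/P.
  have -> : (top M D' + dx + (dp + e)) ^+ 2 = P ^+ 2 + 2 * P * e + e ^+ 2.
    by rewrite /P; ring.
  have -> : (dp + e) ^+ 2 = dp ^+ 2 + 2 * dp * e + e ^+ 2 by ring.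
  move: (norm2 _ _) (cost _) (top _ _) => N C t; lra.
have P0 : 0 < P by rewrite /P; lra.
move=> dpE; rewrite -(ltr_pM2r P0) mul1r.
by move: dpE; rewrite /P; lra.
Qed.

(** At M = 0, energy minus q times norm has derivative -2 s in [M], with s = v0 + v1 + q mass. If s
    > 0, raising [M] by s / 2 would violate the bound; so the nonnegative terms of [s] vanish. *)
Lemma extremal_base0 : 0 <= v0 -> 0 <= v1 -> M = 0 ->
  [/\ v0 = 0, v1 = 0 & norm2 M D = 0].
Proof.
move=> v00 v10 M0; have m0 : 0 <= mass M D by rewrite mass_ge0 ?M0.
suff m1 : v0 + v1 + q * mass M D <= 0.
  have qm0 := mulr_ge0 (ltW q_gt0) m0.
  have v0E : v0 = 0 by lra.
  have v1E : v1 = 0 by lra.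
  split=> //; apply: mass0_norm2 => //; first by rewrite M0.
  by rewrite -(pmulr_rle0 _ q_gt0); lra.
have [s sE] : exists s, s = v0 + v1 + q * mass M D by eexists.
rewrite -sE leNgt; apply/negP => s0.
have := qP v0 v1 (M + s / 2) sizeD; move: extD; rewrite /comb_extremal.
have e0 : 0 <= s / 2 by lra.
have := ler_wpM2l (ltW q_gt0) (norm2_shift M D e0).
have -> : q * (norm2 M D + 2 * (s / 2) * mass M D) =
  q * norm2 M D + s * (s - v0 - v1) by rewrite sE; field.
have := mulr_ge0 (ltW q_gt0) (sqr_ge0 (s / 2)); have := mulr_gt0 s0 s0.
move: (norm2 _ _) (norm2 _ _) => N N'; rewrite M0 add0r.
have := mulr_ge0 (ltW s0) v00; have := mulr_ge0 (ltW s0) v10; lra.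
Qed.

(** Stationarity in [v0] and [v1] gives v0 = v1 and M = (3 - q) v0 with q < 1: in the triangle, the
    maximum is attained at the base alone. *)
Lemma extremal_strict : (0 < k)%N -> 0 < M -> `|v0| <= M -> `|v1| <= M ->
  `|v0| < M /\ `|v1| < M.
Proof.
move=> k0 M0 v0M v1M; have q1 := extremal_lt1 M0 k0.
have e0 : v0 + v1 - (M - v0) - q * v0 = 0.
  apply: (@linear_term0 _ _ (2 - q)) => e.
  by have := qP (v0 + e) v1 M sizeD; move: extD; rewrite /comb_extremal; lra.
have e1 : v0 + v1 - (M - v1) - q * v1 = 0.
  apply: (@linear_term0 _ _ (2 - q)) => e.
  by have := qP v0 (v1 + e) M sizeD; move: extD; rewrite /comb_extremal; lra.
have v01 : v0 = v1.
  have /eqP : (1 - q) * (v0 - v1) = 0 by lra.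
  by rewrite mulf_eq0 => /orP[] /eqP; lra.
subst v1; have ME : M = (3 - q) * v0 by lra.
have v0_gt0 : 0 < v0 by rewrite -(pmulr_rgt0 _ (_ : 0 < 3 - q)) -?ME //; lra.
rewrite gtr0_norm //; split; rewrite ME; nra.
Qed.

End Extremal.

End Comb.

(** * Folding a long cycle onto a triangle with a comb *)

Section Fold.
Variable R : realFieldType.
Implicit Types (u s z r l : nat -> R) (D : seq (R * R)).

(** Each difference of [u] is spent twice, on a backbone edge and on a pendant edge, matching the
    two copies of an edge in a symmetric vector. *)
Fixpoint walk u n : seq (R * R) :=
  if n is m.+1 then (`|u m - u n|, `|u m - u n|) :: walk u m else [::].

Lemma size_walk u n : size (walk u n) = n.
Proof. by elim: n => //= n ->. Qed.

Lemma nneg_walk u n : nneg (walk u n).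
Proof. by elim: n => //= n ->; rewrite !normr_ge0. Qed.

Lemma cost_walk u n : cost (walk u n) = \sum_(i < n) 2 * (u i - u i.+1) ^+ 2.
Proof.
elim: n => [|n IHn]; first by rewrite big_ord0.
by rewrite big_ord_recr /= IHn !real_normK ?num_real //; ring.
Qed.

Lemma top_walk M e u n : `|u 0%N| + e <= M -> `|u n| + e <= top M (walk u n).
Proof.
move=> M0; elim: n => //= n IHn; apply: le_trans (lerD IHn (lexx _)).
have := ler_normB (u n) (u n - u n.+1); rewrite subKr; lra.
Qed.

(** Since [top] dominates |u|, the backbone vertex of the last tooth pays for the new value of [u]
    and its pendant vertex for the previous one. *)
Lemma norm2_walk u n :
  \sum_(i < n) (u i ^+ 2 + u i.+1 ^+ 2) <= norm2 `|u 0%N| (walk u n).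
Proof.
have T k : `|u k| <= top `|u 0%N| (walk u k).
  by have := @top_walk `|u 0%N| 0 u k; rewrite !addr0; apply.
elim: n => [|n IHn]; first by rewrite big_ord0.
rewrite big_ord_recr; have := T n; have := T n.+1; move: IHn => /=.
rewrite -(real_normK (num_real (u n))) -(real_normK (num_real (u n.+1))).
have := normr_ge0 (u n - u n.+1); have := normr_ge0 (u n).
have := normr_ge0 (u n.+1).
move: (\sum_(_ < _) _) (norm2 _ _) (top _ _) `|u n| `|u n.+1| `|_ - _|.
by move=> S N t x y d x0 y0 d0 SN yt xt; nra.
Qed.

Lemma norm2_walk_strict u n : (0 < n)%N ->
  all (fun d => (0 < d.1) && (0 < d.2)) (walk u n) ->
  \sum_(i < n) (u i ^+ 2 + u i.+1 ^+ 2) < norm2 `|u 0%N| (walk u n).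
Proof.
case: n => // n _ /= /andP[/andP[dpos _] _].
have T k : `|u k| <= top `|u 0%N| (walk u k).
  by have := @top_walk `|u 0%N| 0 u k; rewrite !addr0; apply.
rewrite big_ord_recr; have := T n; have := T n.+1; have := norm2_walk u n => /=.
rewrite -(real_normK (num_real (u n))) -(real_normK (num_real (u n.+1))).
move: dpos; have := normr_ge0 (u n); have := normr_ge0 (u n.+1).
move: (\sum_(_ < _) _) (norm2 _ _) (top _ _) `|u n| `|u n.+1| `|_ - _|.
by move=> S N t x y d x0 y0 d0 SN yt xt; nra.
Qed.

(** The head start [e] is cashed in at the first tooth only. *)
Lemma norm2_walk_shift M e u n : 0 <= e -> `|u 0%N| + e <= M ->
  \sum_(i < n.+1) 2 * u i.+1 ^+ 2 + 2 * e * (`|u 0%N| + e) <=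
  norm2 M (walk u n.+1).
Proof.
move=> e0 uM; have T j := top_walk j uM.
elim: n => [|n IHn].
  have := top_ge M (nneg_walk u 1%N); have := T 1%N.
  rewrite big_ord_recr big_ord0 /= !add0r.
  rewrite -(real_normK (num_real (u 1%N))); have := normr_ge0 (u 0%N - u 1%N).
  have := normr_ge0 (u 1%N); have := normr_ge0 (u 0%N).
  move: `|u 0%N| uM `|u 1%N| `|_ - _| => x xM y d x0 y0 d0 yt Mt; nra.
have := T n.+2; rewrite big_ord_recr -[walk u n.+2]/(_ :: walk u n.+1).
move: (walk u n.+1) IHn => W IHn; rewrite /= -(real_normK (num_real (u n.+2))).
have := normr_ge0 (u n.+1 - u n.+2); have := normr_ge0 (u n.+2); move: IHn.
move: (\sum_(_ < _) _) (norm2 _ _) (top _ _) (2 * e * _) `|u n.+2| `|_ - _|.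
by move=> S N t c y d y0 d0 SN yt; nra.
Qed.

Lemma big_ord_down (F : nat -> nat -> R) n :
  \sum_(i < n) F (n - i)%N (n - i.+1)%N = \sum_(i < n) F i.+1 i.
Proof.
rewrite (reindex_inj rev_ord_inj) /=; apply: eq_bigr => i _.
by congr (F _ _); have := ltn_ord i; lia.
Qed.

Variables (q : R) (k : nat).
Hypothesis (q_gt0 : 0 < q) (qP : comb_bound q k).

(* [s i] is the value at the two vertices at distance [i] from the base on a cycle
   of length 2m + 5. The two copies of an edge become one backbone edge and one
   pendant edge, except for the last two edges, which form the triangle. *)
Lemma fold_sym s m D : (size D + m.+1)%N = k -> nneg D ->
  let N := s 0%N ^+ 2 + \sum_(i < m.+2) 2 * s i.+1 ^+ 2 + norm2 `|s 0%N| D in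
  let E := \sum_(i < m.+2) 2 * (s i - s i.+1) ^+ 2 + (2 * s m.+2) ^+ 2 + cost D in
  q * N <= E /\ (q * N = E -> N = 0).
Proof.
(* The walk runs backwards: the triangle sits at the far end of the cycle, and the walk ends at
   [s 0], from where [D] continues. *)
move=> sizeD D0 N E; pose u i := s (m.+1 - i)%N.
have u0 : u 0%N = s m.+1 by rewrite /u subn0.
have um : u m.+1 = s 0%N by rewrite /u subnn.
set M := `|u 0%N|; set v := `|s m.+2|; pose W := walk u m.+1.
have Wtop : `|s 0%N| <= top M W.
  by have := @top_walk M 0 u m.+1; rewrite um !addr0; apply.
have sizeDW : size (D ++ W) = k by rewrite size_cat size_walk.
have DW0 : nneg (D ++ W) by rewrite /nneg all_cat; apply/andP; split=> //; exact: (nneg_walk u m.+1).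
have Mv : (M - v) ^+ 2 <= (s m.+1 - s m.+2) ^+ 2.
  rewrite -(real_normK (num_real (s m.+1 - s m.+2))) -(real_normK (num_real (M - v))).
  rewrite lerXn2r ?nnegrE ?normr_ge0 // /M u0.
  exact: ler_dist_dist.
have vE : v ^+ 2 = s m.+2 ^+ 2 by rewrite real_normK ?num_real.
have ME : M ^+ 2 = s m.+1 ^+ 2 by rewrite real_normK ?num_real // u0.
pose SW := \sum_(i < m.+1) (u i ^+ 2 + u i.+1 ^+ 2).
have SWE : SW = \sum_(i < m.+1) (s i.+1 ^+ 2 + s i ^+ 2).
  exact: (big_ord_down (fun i j => s i ^+ 2 + s j ^+ 2)).
have NE : N = v ^+ 2 + v ^+ 2 + M ^+ 2 + SW + norm2 `|s 0%N| D.
  rewrite /N vE ME SWE; congr (_ + _); rewrite big_ord_recr /=.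
  suff: s 0%N ^+ 2 + \sum_(i < m.+1) 2 * s i.+1 ^+ 2 =
      s m.+1 ^+ 2 + \sum_(i < m.+1) (s i.+1 ^+ 2 + s i ^+ 2) by lra.
  elim: (m.+1) => [|n IHn]; first by rewrite !big_ord0.
  by rewrite !big_ord_recr /=; lra.
have EE : (v + v) ^+ 2 + (M - v) ^+ 2 + (M - v) ^+ 2 + cost (D ++ W) <= E.
  rewrite /E cost_cat /W cost_walk.
  have -> : \sum_(i < m.+1) 2 * (u i - u i.+1) ^+ 2 =
      \sum_(i < m.+1) 2 * (s i - s i.+1) ^+ 2.
    rewrite (big_ord_down (fun i j => 2 * (s i - s j) ^+ 2)).
    by apply: eq_bigr => i _; ring.
  rewrite [X in _ <= X + _ + _]big_ord_recr /= exprMn -vE; lra.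
have W2 := norm2_walk u m.+1; rewrite -/W -/M -/SW in W2.
have D2 := norm2_mono (normr_ge0 (s 0%N)) Wtop D0.
have NN : N <= v ^+ 2 + v ^+ 2 + M ^+ 2 + norm2 M (D ++ W).
  by rewrite NE norm2_cat; lra.
have HI := qP v v M sizeDW.
have qNN := ler_wpM2l (ltW q_gt0) NN.
split; first by lra.
move=> eqN; have ext : comb_extremal q v v M (D ++ W).
  by rewrite /comb_extremal; lra.
have eqNN : N = v ^+ 2 + v ^+ 2 + M ^+ 2 + norm2 M (D ++ W).
  by apply: (mulfI (lt0r_neq0 q_gt0)); lra.
have M0 : 0 <= M := normr_ge0 _; have v0 : 0 <= v := normr_ge0 _.
move: M0; rewrite le_eqVlt => /predU1P[M0|M0].
  have [vz _ nz] := extremal_base0 q_gt0 qP sizeDW DW0 ext v0 v0 (esym M0).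
  by rewrite eqNN nz vz -M0 expr0n /= !addr0.
(* If M > 0, the differences of the walk are positive, which makes [norm2_walk] strict and
   contradicts equality. *)
have := extremal_gt0 q_gt0 qP sizeDW DW0 ext M0; rewrite all_cat => /andP[_].
move=> /norm2_walk_strict -/(_ isT); rewrite -/W -/M -/SW => W2'.
by move: eqNN; rewrite NE norm2_cat; lra.
Qed.

(* The cycle edges at the base carry the energy 2 x^2 with x = |s 1|; the triangle
   with edge values 4x/5, hence vertex values 2x/5, 2x/5 and 6x/5, costs only
   48 x^2 / 25, and what it lacks in norm is recovered at the first tooth. *)
Lemma fold_antisym s m : (m.+1 <= k)%N -> s 0%N = 0 ->
  q * (\sum_(i < m.+2) 2 * s i.+1 ^+ 2) <= \sum_(i < m.+2) 2 * (s i - s i.+1) ^+ 2.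
Proof.
move=> mk s0; pose u i := s i.+1; set x := `|u 0%N|.
have x0 : 0 <= x := normr_ge0 _.
have xE : x ^+ 2 = s 1%N ^+ 2 by rewrite real_normK ?num_real.
(* Teeth with zero differences pad the comb to size [k] at no cost. *)
pose Z := nseq (k - m.+1) (0 : R, 0 : R); pose W := walk u m.+1.
have sZ : size (Z ++ W) = k by rewrite size_cat size_nseq size_walk subnK.
have cZ : cost Z = 0 by rewrite /Z; elim: (k - m.+1)%N => //= n ->; ring.
have -> : \sum_(i < m.+2) 2 * s i.+1 ^+ 2 = 2 * x ^+ 2 + \sum_(i < m.+1) 2 * u i.+1 ^+ 2.
  by rewrite big_ord_recl xE; congr (_ + _); apply: eq_bigr => i _; rewrite lift0.
have -> : \sum_(i < m.+2) 2 * (s i - s i.+1) ^+ 2 =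
    2 * x ^+ 2 + \sum_(i < m.+1) 2 * (u i - u i.+1) ^+ 2.
  rewrite big_ord_recl; congr (_ + _); first by rewrite /= s0 sub0r sqrrN xE.
have HI := qP (x * (2 / 5)) (x * (2 / 5)) (x * (6 / 5)) sZ.
rewrite norm2_cat cost_cat cZ cost_walk in HI.
have := norm2_ge0 (top (x * (6 / 5)) W) Z.
(* The head start x/5 brings 12 x^2 / 25; with the 44 x^2 / 25 of the triangle this exceeds the
   required 2 x^2. *)
have := @norm2_walk_shift (x * (6 / 5)) (x / 5) u m ltac:(lra) ltac:(rewrite -/x; lra).
rewrite -/W -/x; move: HI; rewrite -/W.
move: (norm2 _ _) (norm2 _ _) (\sum_(_ < _) _) (\sum_(_ < _) _) => A B T S.
move=> HI AS B0.
have := ler_wpM2l (ltW q_gt0) AS; have := mulr_ge0 (ltW q_gt0) B0.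
have := mulr_ge0 (ltW q_gt0) (sqr_ge0 x); have := sqr_ge0 x; lra.
Qed.

(** [r] and [l] run along the two halves of the cycle from the base. Their half-sum and
    half-difference decouple in norm and energy, and the half-difference vanishes at the base. *)
Lemma fold_cycle r l m D : (size D + m.+1)%N = k -> nneg D -> r 0%N = l 0%N ->
  let N := r 0%N ^+ 2 + \sum_(i < m.+2) (r i.+1 ^+ 2 + l i.+1 ^+ 2) +
    norm2 `|r 0%N| D in
  let E := \sum_(i < m.+2) ((r i - r i.+1) ^+ 2 + (l i - l i.+1) ^+ 2) +
    (r m.+2 + l m.+2) ^+ 2 + cost D in
  q * N <= E /\ (q * N = E -> r 0%N = 0 /\ norm2 `|r 0%N| D = 0).
Proof.
move=> sizeD D0 rl N E; pose s i := (r i + l i) / 2; pose t i := (r i - l i) / 2.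
have s0 : s 0%N = r 0%N by rewrite /s -rl; field.
have t0 : t 0%N = 0 by rewrite /t -rl subrr mul0r.
have mk : (m.+1 <= k)%N by rewrite -sizeD leq_addl.
have := fold_antisym mk t0; have [] := fold_sym s sizeD D0.
have Nst : N = s 0%N ^+ 2 + \sum_(i < m.+2) 2 * s i.+1 ^+ 2 + norm2 `|s 0%N| D +
    \sum_(i < m.+2) 2 * t i.+1 ^+ 2.
  rewrite s0 addrAC -[_ + \sum_(_ < _) _ + \sum_(_ < _) _]addrA -big_split /=.
  by congr (_ + _ + _); apply: eq_bigr => i _; rewrite /s /t; field.
have Est : E = \sum_(i < m.+2) 2 * (s i - s i.+1) ^+ 2 + (2 * s m.+2) ^+ 2 + cost D +
    \sum_(i < m.+2) 2 * (t i - t i.+1) ^+ 2.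
  rewrite /E; have -> : r m.+2 + l m.+2 = 2 * s m.+2 by rewrite /s; field.
  have -> : \sum_(i < m.+2) ((r i - r i.+1) ^+ 2 + (l i - l i.+1) ^+ 2) =
    \sum_(i < m.+2) 2 * (s i - s i.+1) ^+ 2 + \sum_(i < m.+2) 2 * (t i - t i.+1) ^+ 2.
    by rewrite -big_split /=; apply: eq_bigr => i _; rewrite /s /t; field.
  by ring.
rewrite {}Nst {}Est s0 mulrDr => symle symeq antile; split; first by lra.
move=> eqE; have N0 := symeq ltac:(lra).
have S0 : 0 <= \sum_(i < m.+2) 2 * s i.+1 ^+ 2.
  by apply: sumr_ge0 => i _; rewrite mulr_ge0 ?sqr_ge0.
have D2 := norm2_ge0 `|r 0%N| D; have r2 := sqr_ge0 (r 0%N).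
by split; [apply/eqP; rewrite -sqrf_eq0; apply/eqP|]; lra.
Qed.

End Fold.

Lemma extend_seq (T : Type) (X : nat -> T) n v :
  exists2 Y : nat -> T, (forall t, (t <= n)%N -> Y t = X t) & Y n.+1 = v.
Proof.
exists (fun t => if t == n.+1 then v else X t); last by rewrite eqxx.
by move=> t tn; case: eqP => // tE; move: tn; rewrite tE ltnn.
Qed.

(** Turns differences back into backbone values [X] and pendant values [P], indexed from the base
    instead of from the far end. *)
Lemma comb_sequence (R : realFieldType) (M : R) D : exists X P : nat -> R,
  [/\ X 0%N = M, X (size D) = top M D,
      norm2 M D = \sum_(t < size D) (X t.+1 ^+ 2 + P t.+1 ^+ 2) &
      cost D = \sum_(t < size D) ((X t.+1 - X t) ^+ 2 + (P t.+1 - X t.+1) ^+ 2)].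
Proof.
elim: D => [|[dx dp] D [X [P [X0 Xtop NE CE]]]].
  by exists (fun=> M), (fun=> M); rewrite !big_ord0.
have [X' X'E X'S] := extend_seq X (size D) (top M D + dx).
have [P' P'E P'S] := extend_seq P (size D) (top M D + dx + dp).
exists X', P'; split=> //=; first by rewrite X'E.
  rewrite big_ord_recr /= X'S P'S NE addrA; congr (_ + _ + _).
  by apply: eq_bigr => t _; rewrite X'E ?P'E.
rewrite big_ord_recr /= X'S P'S X'E // Xtop CE addrA; congr (_ + _ + _).
- by apply: eq_bigr => t _; rewrite !X'E ?P'E // ltnW.
- by congr (_ ^+ 2); ring.
- by congr (_ ^+ 2); ring.
Qed.

(** * The graph H_{3,k} as a triangle with a comb *)

Section H3.
Variable k : nat.

Definition H3_next_nat (j : nat) : nat :=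
  if j == 0%N then 1%N else if j == 1%N then 2%N else if j == 2%N then 0%N
  else if (j < k + 4)%N then j.-1 else (j - k.+1)%N.

Lemma H3_next_subproof (i : H3 k) : (H3_next_nat (i : 'I__) < k.*2 + 3)%N.
Proof.
rewrite /H3_next_nat; have := ltn_ord (i : 'I__).
by do !case: ifP => ?; lia.
Qed.

Definition H3_next (i : H3 k) : H3 k := Ordinal (H3_next_subproof i).

Lemma H3_adjE (i j : H3 k) : adj i j = (j == H3_next i) || (i == H3_next j).
Proof.
rewrite -!val_eqE /= /H3_adj /H3_arc !inE !xpair_eqE.
move: (ltn_ord i) (ltn_ord j); move: (nat_of_ord i) (nat_of_ord j) => {}i {}j.
by rewrite /H3_next_nat => ik jk; do !case: ifP => ?; lia.
Qed.

Lemma H3_next2 (i : H3 k) : H3_next (H3_next i) != i.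
Proof.
rewrite -val_eqE /=; have := ltn_ord i; move: (nat_of_ord i) => {}i ik.
rewrite [X in H3_next_nat X]/H3_next_nat.
by do !case: ifP => ?; rewrite /H3_next_nat /=; do ?case: ifP => ?; lia.
Qed.

Lemma card_H3 : #|H3 k| = (k.*2 + 3)%N.
Proof. exact: card_ord. Qed.

Lemma card_H3_gt0 : (0 < #|H3 k|)%N.
Proof. by rewrite card_H3 addn3. Qed.

Variable R : realType.

Lemma sum_H3 (F : nat -> R) : \sum_(i : H3 k) F (i : 'I__) =
  F 0%N + F 1%N + F 2%N + \sum_(t < k) F (t + 3)%N + \sum_(t < k) F (k + 3 + t)%N.
Proof.
transitivity (\sum_(0 <= i < k.*2 + 3) F i); first by rewrite big_mkord.
rewrite (big_cat_nat (n := 3%N)) ?(leq_addl, leq0n) //=.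
rewrite [X in _ + X](big_cat_nat (n := (k + 3)%N)) //=; [|lia|lia].
rewrite addrA; congr (_ + _ + _).
- by rewrite !big_nat_recr //= big_nil add0r.
- by rewrite -{1}[3%N]add0n big_addn addnK big_mkord.
- rewrite -{1}[(k + 3)%N]add0n big_addn big_mkord.
  have -> : (k.*2 + 3 - (k + 3) = k)%N by lia.
  by apply: eq_bigr => t _; rewrite addnC.
Qed.

(** Number k + 3 + t is the pendant vertex of tooth t, except that k + 3, the end of the path,
    serves as that of tooth k. *)
Lemma sum_pendant (F : nat -> R) : \sum_(t < k) F (if t == 0%N :> nat then k else t) =
  \sum_(t < k) F t.+1.
Proof.
case: k => [|n]; first by rewrite !big_ord0.
by rewrite big_ord_recl big_ord_recr /= addrC.
Qed.

(** The alternating signs turn the sums along edges into differences, except on the triangle edge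
    between 0 and 1. *)
Definition H3_vector (v0 v1 : R) (X P : nat -> R) (j : nat) : R :=
  if j == 0%N then - v0 else if j == 1%N then - v1
  else if (j < k + 3)%N then (-1) ^+ (j - 2) * X (j - 2)%N
  else let t := if j == (k + 3)%N then k else (j - (k + 3))%N in
       - ((-1) ^+ t * P t).

Lemma H3_comb_bound : comb_bound (q_min R (H3 k)) k.
Proof.
move=> v0 v1 M D sizeD; have [X [P [X0 _ -> ->]]] := comb_sequence M D.
rewrite sizeD {D sizeD}; pose y := H3_vector v0 v1 X P.
have := q_min_le H3_adjE H3_next2 (fun i : H3 k => y (i : 'I__)) card_H3_gt0.
have yX t : (t <= k)%N -> y (t + 2)%N = (-1) ^+ t * X t.
  move=> tk; rewrite /y /H3_vector addnK.
  by do !case: ifP => ? //; lia.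
have yP t : (t < k)%N -> let t' := if t == 0%N then k else t in
    y (k + 3 + t)%N = - ((-1) ^+ t' * P t').
  move=> tk /=; rewrite /y /H3_vector.
  have -> : (k + 3 + t == 0 = false)%N by lia.
  have -> : (k + 3 + t == 1 = false)%N by lia.
  have -> : (k + 3 + t < k + 3 = false)%N by lia.
  rewrite addKn; have -> : (k + 3 + t == k + 3 = (t == 0))%N by lia.
  by [].
have y0 : y 0%N = - v0 by []; have y1 : y 1%N = - v1 by [].
have y2 : y 2%N = M by rewrite -[2%N]/(0 + 2)%N yX // X0 mul1r.
rewrite /energy /H3_next /= (sum_H3 (fun j => y j ^+ 2)).
rewrite (sum_H3 (fun j => (y j + y (H3_next_nat j)) ^+ 2)).
have -> : H3_next_nat 0 = 1%N by []; have -> : H3_next_nat 1 = 2%N by [].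
have -> : H3_next_nat 2 = 0%N by []; rewrite y2 y1 y0.
have -> : \sum_(t < k) y (t + 3)%N ^+ 2 = \sum_(t < k) X t.+1 ^+ 2.
  apply: eq_bigr => t _; rewrite -addSnnS yX // exprMn sqrr_sign mul1r //.
have -> : \sum_(t < k) y (k + 3 + t)%N ^+ 2 = \sum_(t < k) P t.+1 ^+ 2.
  rewrite -(sum_pendant (fun t => P t ^+ 2)); apply: eq_bigr => t _.
  by rewrite yP // sqrrN exprMn sqrr_sign mul1r.
have -> : \sum_(t < k) (y (t + 3)%N + y (H3_next_nat (t + 3))) ^+ 2 =
    \sum_(t < k) (X t.+1 - X t) ^+ 2.
  apply: eq_bigr => t _; have -> : H3_next_nat (t + 3) = (t + 2)%N.
    by rewrite /H3_next_nat; have := ltn_ord t; do !case: ifP => ?; lia.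
  rewrite -addSnnS !yX //; last exact: ltnW.
  have -> : (-1) ^+ t.+1 * X t.+1 + (-1) ^+ t * X t = (-1) ^+ t.+1 * (X t.+1 - X t).
    by rewrite exprS; ring.
  by rewrite exprMn sqrr_sign mul1r.
have -> : \sum_(t < k) (y (k + 3 + t)%N + y (H3_next_nat (k + 3 + t))) ^+ 2 =
    \sum_(t < k) (P t.+1 - X t.+1) ^+ 2.
  rewrite -(sum_pendant (fun t => (P t - X t) ^+ 2)); apply: eq_bigr => t _.
  have tk := ltn_ord t; rewrite yP //; set t' := if _ then _ else _.
  have -> : H3_next_nat (k + 3 + t) = (t' + 2)%N.
    by rewrite /H3_next_nat /t'; do !case: ifP => ?; lia.
  rewrite yX; last by rewrite /t'; case: ifP => // _; exact: ltnW.
  have -> : - ((-1) ^+ t' * P t') + (-1) ^+ t' * X t' = (-1) ^+ t' * (X t' - P t').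
    by ring.
  by rewrite exprMn sqrr_sign mul1r -sqrrN opprB.
rewrite !big_split /=.
move: (q_min _ _) (\sum_(_ < _) _) (\sum_(_ < _) _) (\sum_(_ < _) _) (\sum_(_ < _) _).
by move=> q A B C E; lra.
Qed.

(** Otherwise an eigenvector [f] would have zero energy and change sign along every edge. The
    triangle forces it to vanish there, hence everywhere, as numbers decrease along [H3_next]
    outside the triangle. *)
Lemma q_min_H3_gt0 : 0 < q_min R (H3 k).
Proof.
have [|f [x fx] fE] := q_min_attained R H3_adjE H3_next2; first exact: card_H3_gt0.
rewrite ltNge; apply/negP => q0; apply/negP: fx; rewrite negbK.
have E0 : energy H3_next f <= 0.
  by rewrite fE mulr_le0_ge0 // sumr_ge0 // => i _; rewrite sqr_ge0.
have fN i : f i = - f (H3_next i).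
  apply/eqP; rewrite -addr_eq0 -sqrf_eq0 eq_le sqr_ge0 andbT.
  apply: le_trans E0; rewrite /energy (bigD1 i) //= lerDl.
  by rewrite sumr_ge0 // => j _; rewrite sqr_ge0.
have lt3 j : (j < 3)%N -> (j < k.*2 + 3)%N by lia.
pose o j (j3 : (j < 3)%N) : H3 k := Ordinal (lt3 j j3).
have nx j j3 j' j3' : H3_next_nat j = j' -> H3_next (o j j3) = o j' j3'.
  by move=> E; apply: val_inj.
have f0 : f (o 0%N isT) = 0.
  have E1 := fN (o 0%N isT); have E2 := fN (o 1%N isT); have E3 := fN (o 2%N isT).
  rewrite (nx _ _ 1%N isT) // in E1; rewrite (nx _ _ 2%N isT) // in E2.
  by rewrite (nx _ _ 0%N isT) // in E3; lra.
have [n] := ubnP (nat_of_ord x); elim: n x => // n IHn x xn.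
case: (ltnP x 3) => [x3|x3]; last first.
  rewrite fN oppr_eq0; apply: IHn; rewrite /= /H3_next_nat.
  by move: (ltn_ord x); do !case: ifP => ?; lia.
have E1 := fN (o 1%N isT); rewrite (nx _ _ 2%N isT) // in E1.
have E2 := fN (o 2%N isT); rewrite (nx _ _ 0%N isT) // f0 oppr0 in E2.
rewrite E2 oppr0 in E1.
have xE : x = o x x3 by apply: val_inj.
rewrite xE; apply/eqP; case: (nat_of_ord x) x3 {xE} => [|[|[|]]] // x3.
- by rewrite -f0; congr f; apply: val_inj.
- by rewrite -E1; congr f; apply: val_inj.
- by rewrite -E2; congr f; apply: val_inj.
Qed.

End H3.

(** * Comparison with the comb *)

Lemma sum_tail_rev (R : nmodType) (F : nat -> R) n m :
  \sum_(i < n + m) F i = \sum_(i < n) F i + \sum_(i < m) F ((n + m).-1 - i)%N.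
Proof.
rewrite big_split_ord /=; congr (_ + _); rewrite (reindex_inj rev_ord_inj) /=.
by apply: eq_bigr => i _; congr F; have := ltn_ord i; lia.
Qed.

Lemma ler_sqr_norm (R : realDomainType) (x y : R) : `|x| <= y -> `|x| ^+ 2 <= y ^+ 2.
Proof.
move=> xy; rewrite lerXn2r // nnegrE ?normr_ge0 //.
exact: le_trans (normr_ge0 x) xy.
Qed.

Lemma eq_sqr_norm (R : realDomainType) (x y : R) :
  `|x| <= y -> `|x| ^+ 2 = y ^+ 2 -> `|x| = y.
Proof.
move=> xy /eqP; rewrite eqrXn2 ?normr_ge0 //; first by move/eqP.
exact: le_trans (normr_ge0 x) xy.
Qed.

Section Estimate.
Variables (R : realType) (G : sgraph) (nxt : G -> G) (a : G).
Hypothesis adjE : forall x y, adj x y = (y == nxt x) || (x == nxt y).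
Hypothesis nxt2 : forall x, nxt (nxt x) != x.
Hypothesis to_a : forall x, fconnect nxt x a.
Hypothesis nonbip : ~ bipartite G.
Local Notation C := (cyc nxt a).

Variable f : G -> R.

Definition jump x := `|f x + f (nxt x)|.
Definition jumps (L : seq (G * G)) := [seq (jump xy.1, jump xy.2) | xy <- L].

Lemma nneg_jumps L : nneg (jumps L).
Proof. by elim: L => //= xy L ->; rewrite !normr_ge0. Qed.

Lemma cost_jumps L : cost (jumps L) = \sum_(x <- flat L) (f x + f (nxt x)) ^+ 2.
Proof.
elim: L => [|[x y] L IHL] /=; first by rewrite big_nil.
by rewrite !big_cons IHL !real_normK ?num_real //; ring.
Qed.

Lemma le_jump x : `|f x| <= `|f (nxt x)| + jump x.
Proof.
have := ler_normB (f x + f (nxt x)) (f (nxt x)); rewrite addrK /jump; lra.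
Qed.

Variable M : R.
Hypothesis M_ge : forall c, c \in C -> `|f c| <= M.

(** A pair may hang from the cycle or any earlier pair; the comb hangs it from the latest one, where
    [top] is largest. *)
Lemma comb_top L x : comb nxt a L -> (x \in C) || (x \in unzip1 L) ->
  `|f x| <= top M (jumps L).
Proof.
elim: L x => [|[y z] L IHL] x /=; first by rewrite orbF => _ /M_ge.
case/and3P=> cy _ cL; have Ly := IHL _ cL cy; have := le_jump y.
rewrite in_cons orbCA => jy /orP[/eqP->|/(IHL _ cL)]; first by lra.
by have := normr_ge0 (f y + f (nxt y)); rewrite -/(jump y); lra.
Qed.

Lemma comb_pair_le x y L : comb nxt a ((x, y) :: L) ->
  `|f x| <= top M (jumps L) + jump x /\
  `|f y| <= top M (jumps L) + jump x + jump y.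
Proof.
move=> cL; have fx := comb_top (x := x) cL; have fy := comb_top (x := nxt y) cL.
rewrite /= mem_head orbT in fx; move: cL => /= /and3P[_ /fy /= cy _].
by have := fx isT; have := le_jump y; lra.
Qed.

Lemma comb_norm2 L : comb nxt a L ->
  \sum_(x <- flat L) f x ^+ 2 <= norm2 M (jumps L).
Proof.
elim: L => [|[x y] L IHL] cL; first by rewrite big_nil.
have [fx fy] := comb_pair_le cL; move: cL => /= /and3P[_ _ /IHL].
rewrite !big_cons -(real_normK (num_real (f x))) -(real_normK (num_real (f y))).
have := ler_sqr_norm fx; have := ler_sqr_norm fy; lra.
Qed.

Fixpoint path_comb (c : G) (L : seq (G * G)) : bool :=
  if L is (x, y) :: L' then
    [&& nxt x == head c (unzip1 L'), nxt y == x & path_comb c L']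
  else true.

(** Equality of norms makes each |f| equal to the comb value. With positive jumps these values
    increase strictly, so only the previous first component, or [c] at the base, is large enough to
    hang from. *)
Lemma comb_exact c L : comb nxt a L ->
  \sum_(x <- flat L) f x ^+ 2 = norm2 M (jumps L) ->
  all (fun d => (0 < d.1) && (0 < d.2)) (jumps L) ->
  (forall x, x \in C -> M <= `|f x| -> x = c) -> path_comb c L.
Proof.
move=> cL0 NL jL Mc; elim: L cL0 NL jL => [//|[x y] L IHL] cL.
have [fx fy] := comb_pair_le cL; move: (cL) => /= /and3P[cx cy cL'].
have NL' := comb_norm2 cL'; rewrite !big_cons.
rewrite -(real_normK (num_real (f x))) -(real_normK (num_real (f y))).
move=> NE /andP[/andP[jx jy] jL].
have [x0 y0] := (normr_ge0 (f x), normr_ge0 (f y)).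
have [fx2 fy2] := (ler_sqr_norm fx, ler_sqr_norm fy).
have fxE : `|f x| = top M (jumps L) + jump x by apply: eq_sqr_norm => //; lra.
have fyE : `|f y| = top M (jumps L) + jump x + jump y by apply: eq_sqr_norm => //; lra.
rewrite IHL ?andbT //; last by lra.
have bound z : (z \in C) || (z \in unzip1 L) -> `|f z| <= top M (jumps L).
  exact: comb_top.
have nx : top M (jumps L) <= `|f (nxt x)| by have := le_jump x; lra.
have ny : top M (jumps L) + jump x <= `|f (nxt y)| by have := le_jump y; lra.
apply/andP; split; last first.
  move: cy; rewrite in_cons orbCA => /orP[//|/bound]; lra.
case: L cx nx jL cL' {IHL cL NL' NE fx fy fxE fyE fx2 fy2 cy bound ny} => [|[u v] L] /=.
  by rewrite orbF => nxC nx _ _; apply/eqP/Mc.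
rewrite in_cons orbCA => /orP[//|cx] nx /andP[/andP[ju _] _] /and3P[_ _ cL].
by have := comb_top cL cx; lra.
Qed.

Lemma sum_combed (F : G -> R) L : spans (flat L) (setT :\: C) ->
  \sum_x F x = \sum_(x in C) F x + \sum_(x <- flat L) F x.
Proof.
move=> [uL LC]; rewrite (bigID (mem C)) /=; congr (_ + _).
by rewrite (big_uniq _ uL) /=; apply: eq_bigl => x; rewrite LC in_setD in_setT andbT.
Qed.

Lemma sum_cyc (F : G -> R) c : c \in C ->
  \sum_(x in C) F x = \sum_(i < #|C|) F (iter i nxt c).
Proof.
move=> cC; have [_ _ _ ug gC] := cyc_traject adjE to_a nonbip cC.
rewrite -(eq_bigl _ _ gC) -(big_uniq _ ug) /= big_map.
by rewrite -val_enum_ord big_map big_enum.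
Qed.

End Estimate.

(** * The bound for long cycles and for triangles *)

Section Main.
Variables (R : realType) (G : sgraph) (nxt : G -> G) (a : G).
Hypothesis adjE : forall x y, adj x y = (y == nxt x) || (x == nxt y).
Hypothesis to_a : forall x, fconnect nxt x a.
Hypothesis nonbip : ~ bipartite G.
Local Notation C := (cyc nxt a).

Variables (L : seq (G * G)) (q : R) (k : nat).
Hypothesis LC : combed nxt a setT L [::].
Hypothesis cardG : #|G| = (k.*2 + 3)%N.
Hypotheses (q_gt0 : 0 < q) (qP : comb_bound q k).

Lemma size_comb : (#|C| + (size L).*2 = k.*2 + 3)%N.
Proof. by rewrite -cardG -cardsT (size_combed (subsetT _) LC) addn0. Qed.

Lemma ex_cyc_max (f : G -> R) : exists2 c, c \in C & forall x, x \in C -> `|f x| <= `|f c|.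
Proof.
have aC := cyc_root to_a.
by case: (Order.TotalTheory.arg_maxP (fun x => `|f x|) aC) => c cC cmax; exists c.
Qed.

(** The cycle is opened at its maximum [c] and handed to [fold_cycle]. Equality gives f c = 0, hence
    f = 0 on the whole cycle. *)
Lemma long_cycle_bound (f : G -> R) : (3 < #|C|)%N ->
  q * (\sum_x f x ^+ 2) <= energy nxt f /\
  (q * (\sum_x f x ^+ 2) = energy nxt f -> \sum_x f x ^+ 2 = 0).
Proof.
move=> C3; have [cL spL _] := LC; have [c cC cmax] := ex_cyc_max f.
rewrite /energy !(sum_combed _ spL) -cost_jumps.
have := comb_norm2 cmax cL; move: (\sum_(x <- flat L) _) => T TN.
have sumN := sum_cyc adjE to_a nonbip (fun x => f x ^+ 2) cC.
have sumE := sum_cyc adjE to_a nonbip (fun x => (f x + f (nxt x)) ^+ 2) cC.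
have [og _ gc _ _] := cyc_traject adjE to_a nonbip cC.
have [m gE] : exists m, #|C| = m.+2.*2.+1.
  by exists (#|C|./2 - 2)%N; have := odd_double_half #|C|; rewrite og; lia.
pose z i := f (iter i nxt c); pose h := m.+2.
have zg : z h.*2.+1 = z 0%N by rewrite /z /h -gE gc.
(* The signs turn sums into differences along both halves; as the length 2h + 1 is odd, the edge
   opposite to [c] keeps its sum. *)
pose r i := (-1) ^+ i * z i; pose l i := (-1) ^+ i * z (h.*2.+1 - i)%N.
have sqs n (x : R) : ((-1) ^+ n * x) ^+ 2 = x ^+ 2 by rewrite exprMn sqrr_sign mul1r.
have sq0 n x y : ((-1) ^+ n * x - (-1) ^+ n.+1 * y) ^+ 2 = (x + y) ^+ 2 :> R.
  by rewrite -(sqs n (x + y)) [(-1) ^+ n.+1]exprS; congr (_ ^+ 2); ring.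
have rl : r 0%N = l 0%N by rewrite /r /l subn0 zg.
have sizeD : (size (jumps nxt f L) + m.+1)%N = k.
  by have := size_comb; rewrite size_map gE; clear; lia.
have fold_sum (F : nat -> R) : \sum_(i < #|C|) F i =
    \sum_(i < h) F i + F h + \sum_(i < h) F (h.*2 - i)%N.
  have -> : #|C| = (h + h.+1)%N by rewrite gE /h; clear; lia.
  rewrite sum_tail_rev -[RHS]addrA; congr (_ + _).
  rewrite big_ord_recr addrC; congr (_ + _).
    by apply: eq_bigr => i _; congr F; rewrite /= /h; clear; lia.
  by congr F; rewrite /= /h; clear; lia.
have NE : \sum_(x in C) f x ^+ 2 = r 0%N ^+ 2 + \sum_(i < h) (r i.+1 ^+ 2 + l i.+1 ^+ 2).
  rewrite sumN (fold_sum (fun i => z i ^+ 2)) big_split /= addrA; congr (_ + _).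
    transitivity (\sum_(i < h.+1) z i ^+ 2); first by rewrite [RHS]big_ord_recr.
    rewrite big_ord_recl sqs.
    by congr (_ + _); apply: eq_bigr => i _; rewrite lift0 sqs.
  by apply: eq_bigr => i _; rewrite sqs subSS.
have EE : \sum_(x in C) (f x + f (nxt x)) ^+ 2 =
    \sum_(i < h) ((r i - r i.+1) ^+ 2 + (l i - l i.+1) ^+ 2) + (r h + l h) ^+ 2.
  rewrite sumE (fold_sum (fun i => (z i + z i.+1) ^+ 2)) big_split /= addrAC.
  congr (_ + _ + _).
  - by apply: eq_bigr => i _; rewrite sq0.
  - apply: eq_bigr => i _; rewrite sq0 addrC; congr ((_ + _) ^+ 2); congr z.
    by have := ltn_ord i; clear; lia.
  - rewrite /r /l -mulrDr sqs; congr ((_ + z _) ^+ 2).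
    by clear; lia.
have r0 : `|r 0%N| = `|f c| by rewrite /r mul1r.
have := fold_cycle q_gt0 qP sizeD (nneg_jumps nxt f L) rl.
rewrite /= -/h r0 -NE -EE; move: TN; set N2 := norm2 _ _ => TN [le eq].
have qTN := ler_wpM2l (ltW q_gt0) TN.
move: le eq; rewrite !mulrDr => le eq; split; first by lra.
move=> E; have [r00 N20] := eq ltac:(lra).
have fc0 : f c = 0 by move/eqP: r0; rewrite r00 normr0 eq_sym normr_eq0 => /eqP.
have -> : T = 0 by apply: (mulfI (lt0r_neq0 q_gt0)); rewrite N20 in qTN le; lra.
rewrite addr0; apply: big1 => x /cmax; rewrite fc0 normr0 normr_le0 => /eqP->.
by rewrite expr0n.
Qed.

Lemma cyc3 c x : #|C| = 3%N -> c \in C -> x \in C ->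
  [\/ x = c, x = nxt c | x = nxt (nxt c)].
Proof.
move=> C3 cC xC; have [_ _ _ _ sC] := cyc_traject adjE to_a nonbip cC.
move: xC; rewrite -sC C3 /= !inE => /or3P[] /eqP->.
- by constructor 1.
- by constructor 2.
- by constructor 3.
Qed.

(** After a change of sign the triangle has the shape of [comb_bound] with base [c]. In the equality
    case [extremal_strict] makes [c] the only maximum, as [comb_exact] requires. *)
Lemma triangle_bound (f : G -> R) c : #|C| = 3%N -> c \in C ->
  (forall x, x \in C -> `|f x| <= `|f c|) ->
  q * (\sum_x f x ^+ 2) <= energy nxt f /\
  (q * (\sum_x f x ^+ 2) = energy nxt f -> \sum_x f x ^+ 2 != 0 ->
   path_comb nxt c L).
Proof.
move=> C3 cC cmax; have [cL spL _] := LC.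
rewrite /energy !(sum_combed _ spL) -cost_jumps.
have TN := comb_norm2 cmax cL; have exact_L := comb_exact cmax cL.
move: (\sum_(x <- flat L) _) TN exact_L => T TN exact_L.
rewrite !(sum_cyc adjE to_a nonbip _ cC) C3 !big_ord_recr !big_ord0 /= !add0r.
have [_ _ c3 _ _] := cyc_traject adjE to_a nonbip cC; rewrite C3 /= in c3.
rewrite c3; have size_D : size (jumps nxt f L) = k.
  by have := size_comb; rewrite size_map C3; clear; lia.
have [e e2 ef] : exists2 e : R, e ^+ 2 = 1 & e * f c = `|f c|.
  case: (ger0P (f c)) => _; first by exists 1; rewrite ?expr1n ?mul1r.
  by exists (-1); rewrite ?sqrrN ?expr1n ?mulN1r.
have ne x : `|- (e * x)| = `|x|.
  rewrite normrN normrM; suff -> : `|e| = 1 by rewrite mul1r.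
  by apply/eqP; rewrite -sqr_norm_eq1 e2.
have sqe x : (e * x) ^+ 2 = x ^+ 2 by rewrite exprMn e2 mul1r.
set v0 := - (e * f (nxt c)); set v1 := - (e * f (nxt (nxt c))).
have c1C := cyc_nxt cC; have c2C := cyc_nxt c1C.
have M0 := normr_ge0 (f c); set M := `|f c| in TN exact_L cmax ef M0.
have v0M : `|v0| <= M by rewrite ne cmax.
have v1M : `|v1| <= M by rewrite ne cmax.
have NE : f c ^+ 2 + f (nxt c) ^+ 2 + f (nxt (nxt c)) ^+ 2 = v0 ^+ 2 + v1 ^+ 2 + M ^+ 2.
  by rewrite /v0 /v1 !sqrrN -ef !sqe; ring.
have EE : (f c + f (nxt c)) ^+ 2 + (f (nxt c) + f (nxt (nxt c))) ^+ 2 +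
    (f (nxt (nxt c)) + f c) ^+ 2 = (v0 + v1) ^+ 2 + (M - v0) ^+ 2 + (M - v1) ^+ 2.
  rewrite /v0 /v1 -ef !opprK -!mulrDr -opprD sqrrN -mulrDr !sqe; ring.
rewrite NE EE; have HI := qP v0 v1 M size_D.
have qTN := ler_wpM2l (ltW q_gt0) TN.
split; first by rewrite mulrDr; rewrite mulrDr in HI; lra.
move=> eqE Nn0; rewrite mulrDr in eqE; rewrite mulrDr in HI.
have D0 := nneg_jumps nxt f L.
have NT : T = norm2 M (jumps nxt f L) by apply: (mulfI (lt0r_neq0 q_gt0)); lra.
have ext : comb_extremal q v0 v1 M (jumps nxt f L).
  by rewrite /comb_extremal mulrDr -NT.
move: (M0); rewrite le_eqVlt => /predU1P[Mz|M_gt0].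
  have vz (v : R) : `|v| <= M -> v = 0.
    by move=> vM; apply/eqP; rewrite -normr_le0 Mz.
  have [||_ _ nz] := extremal_base0 q_gt0 qP size_D D0 ext _ _ (esym Mz).
  - by rewrite (vz _ v0M).
  - by rewrite (vz _ v1M).
  by case/eqP: Nn0; rewrite NT nz (vz _ v0M) (vz _ v1M) -Mz !expr0n /= !addr0.
have [k0|k_gt0] := posnP k.
  by have := size_D; rewrite size_map k0 => /size0nil->.
have [v0M' v1M'] := extremal_strict q_gt0 qP size_D D0 ext k_gt0 M_gt0 v0M v1M.
apply: exact_L => //; first exact: (extremal_gt0 q_gt0 qP size_D D0 ext M_gt0).
move=> x /(cyc3 C3 cC)[//|->|->] Mx.
  by move: v0M'; rewrite ne ltNge Mx.
by move: v1M'; rewrite ne ltNge Mx.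
Qed.

End Main.

(** * Recognizing H_{3,k} *)

Section Path.
Variables (G : sgraph) (nxt : G -> G) (a : G).
Hypothesis adjE : forall x y, adj x y = (y == nxt x) || (x == nxt y).
Hypothesis to_a : forall x, fconnect nxt x a.
Hypothesis nonbip : ~ bipartite G.
Local Notation C := (cyc nxt a).

Lemma path_comb_sequence c L : path_comb nxt c L -> exists x y : nat -> G,
  [/\ x 0%N = c, x (size L) = head c (unzip1 L),
      forall t, (t < size L)%N -> nxt (x t.+1) = x t /\ nxt (y t.+1) = x t.+1 &
      forall z, z \in flat L -> exists2 t, (t < size L)%N & z = x t.+1 \/ z = y t.+1].
Proof.
elim: L => [|[u v] L IHL] /=; first by exists (fun=> c), (fun=> c).
case/and3P=> /eqP uE /eqP vE /IHL[x [y [x0 xL nxy xyL]]].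
have [x' x'E x'u] := extend_seq x (size L) u.
have [y' y'E y'v] := extend_seq y (size L) v.
exists x', y'; split=> //; first by rewrite x'E.
  move=> t; rewrite ltnS leq_eqVlt => /predU1P[->|tL].
    by rewrite x'u y'v x'E // uE xL.
  by rewrite !x'E ?y'E ?(ltnW tL) //; apply: nxy.
move=> z; rewrite !inE => /or3P[/eqP->|/eqP->|/xyL[t tL zt]].
- by exists (size L) => //; left.
- by exists (size L) => //; right.
- by exists t; [exact: ltnW | rewrite x'E ?y'E].
Qed.

(** [psi] numbers the vertices as [H3_vector] does, with [y k] at the end of the path. It
    intertwines [H3_next] with [nxt], and being onto it is bijective by counting. *)
Lemma path_comb_isomorphic c L k : c \in C -> #|C| = 3%N ->
  combed nxt a setT L [::] -> #|G| = (k.*2 + 3)%N -> path_comb nxt c L ->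
  isomorphic G (H3 k).
Proof.
move=> cC C3 LC cG /path_comb_sequence[x [y [x0 _ nxy xyL]]].
have kL : size L = k by have := size_comb LC cG; rewrite C3; clear; lia.
rewrite kL in nxy xyL.
have [_ _ c3 _ _] := cyc_traject adjE to_a nonbip cC; rewrite C3 /= in c3.
pose psi (j : nat) : G := if j == 0%N then nxt c else if j == 1%N then nxt (nxt c)
  else if (j < k + 3)%N then x (j - 2)%N
  else if j == (k + 3)%N then y k else y (j - (k + 3))%N.
pose g (i : H3 k) := psi (i : 'I__).
have psi_x t : (t <= k)%N -> psi (t + 2)%N = x t.
  by move=> tk; rewrite /psi addnK; do !case: ifP => ? //; lia.
have psi0 : psi 0%N = nxt c by [].
have psi1 : psi 1%N = nxt (nxt c) by [].
have psi2 : psi 2%N = c by rewrite -[2%N]/(0 + 2)%N psi_x // x0.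
have g_nxt i : nxt (g i) = g (H3_next i).
  rewrite /g /=; move: (ltn_ord i); move: (nat_of_ord i) => {}i ik.
  case: (ltnP i 3) => [|i3].
    by case: i ik => [|[|[|]]] // _ _; rewrite /H3_next_nat /= psi2 // psi0 psi1 c3.
  have [t [i2 [tk E]]] : exists t, H3_next_nat k i = (t + 2)%N /\ (t <= k)%N /\
      nxt (psi i) = x t.
    case: (ltnP i (k + 3)) => ik3.
      exists (i - 3)%N; rewrite /H3_next_nat; split; first by do !case: ifP => ?; lia.
      split; first by lia.
      have i3k : (i - 3 < k)%N by lia.
      have -> : psi i = x (i - 3).+1 by rewrite -psi_x //; congr psi; lia.
      by case: (nxy _ i3k).
    exists (if i == (k + 3)%N then k else i - (k + 3))%N.
    rewrite /H3_next_nat; split; first by do !case: ifP => ?; lia.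
    split; first by case: ifP => ?; lia.
    rewrite /psi; have -> : (i == 0 = false)%N by lia.
    have -> : (i == 1 = false)%N by lia.
    have -> : (i < k + 3 = false)%N by lia.
    have yx t : (0 < t)%N -> (t <= k)%N -> nxt (y t) = x t.
      by case: t => // t _ /nxy[].
    by case: eqP => ?; apply: yx; lia.
  by rewrite E i2 psi_x.
have g_surj z : exists i, g i = z.
  have ord j (jk : (j < k.*2 + 3)%N) : psi j = z -> exists i, g i = z.
    by exists (Ordinal jk).
  case: (boolP (z \in C)) => [zC|zC].
    case: (cyc3 adjE to_a nonbip C3 cC zC) => zE.
    - apply: (ord 2%N); first by lia.
      by rewrite psi2.
    - by apply: (ord 0%N); [lia | rewrite zE].
    - by apply: (ord 1%N); [lia | rewrite zE].
  have [_ [_ flatE] _] := LC; have := flatE z.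
  rewrite in_setD zC in_setT => /xyL[t tk [zE|zE]].
    by apply: (ord (t.+1 + 2)%N); [lia | rewrite psi_x].
  case: (eqVneq t.+1 k) => [tE|tNk].
    apply: (ord (k + 3)%N); first by lia.
    by rewrite /psi eqxx zE tE; do !case: ifP => ? //; lia.
  apply: (ord (t.+1 + (k + 3))%N); first by lia.
  by rewrite /psi addnK zE; do !case: ifP => ? //; lia.
have cards : #|H3 k| = #|G| by rewrite card_H3 cG.
have g_inj : injective g.
  apply/injectiveP/card_uniqP; rewrite size_map -cardT cards.
  by apply: eq_card => z; rewrite inE; have [i <-] := g_surj z; apply: codom_f.
have g_bij : bijective g by apply: inj_card_bij g_inj _; rewrite cards.
have [f fK gK] := g_bij.
exists f; first by exists g.
move=> u v; rewrite -{2}[u]gK -{2}[v]gK adjE H3_adjE !g_nxt !(inj_eq g_inj).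
by [].
Qed.

End Path.

(** An eigenvector of [H] is pulled back to a test vector on [G]. *)
Lemma q_min_isomorphic_le (R : realType) (G H : sgraph) (nG : G -> G) (nH : H -> H) :
  (forall x y, adj x y = (y == nG x) || (x == nG y)) -> (forall x, nG (nG x) != x) ->
  (forall x y, adj x y = (y == nH x) || (x == nH y)) -> (forall x, nH (nH x) != x) ->
  (0 < #|H|)%N -> isomorphic G H -> q_min R G <= q_min R H.
Proof.
move=> GE G2 HE H2 H0 [h h_bij hE].
have [y [x yx] yE] := q_min_attained R HE H2 H0.
have N0 : 0 < \sum_x y x ^+ 2.
  rewrite (bigD1 x) //= ltr_wpDr ?exprn_even_gt0 ?sumr_ge0 // => i _.
  by rewrite sqr_ge0.
rewrite -(ler_pM2r N0) -yE -(energyE HE H2) {yE}.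
rewrite (reindex h) /=; last exact: onW_bij.
rewrite [X in _ <= X](reindex h) /=; last exact: onW_bij.
under [X in _ <= X]eq_bigr => u _.
  rewrite (reindex h) /=; last exact: onW_bij.
  under eq_bigr => v _ do rewrite hE.
  over.
rewrite (energyE GE G2 (y \o h)); apply: q_min_le => //.
by rewrite (bij_eq_card h_bij).
Qed.

Lemma isomorphic_sym (G H : sgraph) : isomorphic G H -> isomorphic H G.
Proof.
move=> [f [g fK gK] fE]; exists g; first by exists f.
by move=> x y; rewrite -fE !gK.
Qed.

Theorem theorem4p8 (R : realType) (n : nat) (G : sgraph)
    (n_ge3 : (3 <= n)%N) (G_order : #|G| = n)
    (G_unicyclic : unicyclic G) (G_nonbipartite : ~ bipartite G)
    (G_domination : (domination_number G)%:R = (n%:R - 1) / 2 :> R) :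
  let H := H3 ((n - 3) %/ 2)%N in
  q_min R H <= q_min R G /\ (q_min R G = q_min R H <-> isomorphic G H).
Proof.
move=> H; set k := ((n - 3) %/ 2)%N in H *.
have nE : n = (domination_number G).*2.+1.
  apply/eqP; rewrite -(eqr_nat R) -addn1 natrD -muln2 natrM G_domination.
  by apply/eqP; field.
have cardG : #|G| = (k.*2 + 3)%N by rewrite G_order /k; lia.
have G_gt0 : (0 < #|G|)%N by rewrite G_order; lia.
have [nxt [a [adjE nxt2 to_a]]] := unicyclic_functional G_gt0 G_unicyclic.
have needsT : needs [set: G] (domination_number G).
  move=> D /forall_inP DT; apply: (proj2 (domination_numberP G)).
  apply/forall_inP => x; rewrite inE => xD.
  by have := DT x (in_setT x); rewrite (negPf xD).
have [||L LC] := odd_combed (m := domination_number G) adjE nxt2 to_a G_nonbipartite _ needsT.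
- by split=> // x; rewrite in_setT.
- by rewrite cardsT G_order.
have q_gt0 := q_min_H3_gt0 k R; have qP := @H3_comb_bound k R.
(* A longer cycle never attains equality with a nonzero vector, so the isomorphism comes from the
   triangle case. *)
have bound f : q_min R H * (\sum_x f x ^+ 2) <= energy nxt f /\
    (q_min R H * (\sum_x f x ^+ 2) = energy nxt f -> \sum_x f x ^+ 2 != 0 ->
     isomorphic G H).
  have [c cC cmax] := ex_cyc_max to_a f.
  have [_ C2 _ _ _] := cyc_traject adjE to_a G_nonbipartite cC.
  case: (ltnP 3 #|cyc nxt a|) => C3.
    have [le eq] := long_cycle_bound adjE to_a G_nonbipartite LC cardG q_gt0 qP f C3.
    by split=> // /eq ->; rewrite eqxx.
  have {C2}C3 : #|cyc nxt a| = 3%N by apply/eqP; rewrite eqn_leq C3.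
  have [le eq] := triangle_bound adjE to_a G_nonbipartite LC cardG q_gt0 qP C3 cC cmax.
  split=> // fE /(eq fE).
  exact: (path_comb_isomorphic adjE to_a G_nonbipartite cC C3 LC cardG).
have [f [x fx] fE] := q_min_attained R adjE nxt2 G_gt0.
have N_gt0 : 0 < \sum_x f x ^+ 2.
  rewrite (bigD1 x) //= ltr_wpDr ?exprn_even_gt0 ?sumr_ge0 // => i _.
  by rewrite sqr_ge0.
split; first by rewrite -(ler_pM2r N_gt0) -fE; apply: (proj1 (bound f)).
split=> [qE | GH].
  by apply: (proj2 (bound f)); [rewrite fE qE | rewrite gt_eqF].
have HE := @H3_adjE k; have H2 := @H3_next2 k.
apply/eqP; rewrite eq_le; apply/andP; split.
  exact: (q_min_isomorphic_le R adjE nxt2 HE H2 (card_H3_gt0 k) GH).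
exact: (q_min_isomorphic_le R HE H2 adjE nxt2 G_gt0 (isomorphic_sym GH)).
Qed.
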